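(* Let $n\ge 2$ and let $\lambda$ be a partition. For any highest weight element $T\in\mathrm{MVT}^n(\lambda)$ (i.e. $e_iT=0$ for all $i$), the closure of $T$ under the crystal operators is isomorphic to $B(\mu)$, where $\mu=\mathrm{wt}(T)$. Moreover, \[\mathrm{MVT}^n(\lambda)\cong\bigoplus_{\mu\supseteq\lambda}B(\mu)^{\oplus M_\lambda^\mu},\] where $M_\lambda^\mu$ is the number of highest weight elements of weight $\mu$ in $\mathrm{MVT}^n(\lambda)$, and \[\overline{G}_\lambda(\mathbf x;\alpha)=\sum_{\mu\supseteq\lambda}\alpha^{|\mu|-|\lambda|}M_\lambda^\mu\, s_\mu(\mathbf x).\]
   Context: A multiset-valued tableau of shape $\lambda$ with entries at most $n$ is a filling $T$ of the boxes of the Young diagram of $\lambda$ (English convention) by finite nonempty multisets of integers in $\{1,\dots,n\}$ such that for a box $A$ immediately left of a box $B$ in a row, $\max A\le\min B$, and for a box $C$ immediately below a box $A$ in a column, $\max A<\min C$. $\mathrm{MVT}^n(\lambda)$ is the set of these ($\mathrm{MVT}^\infty(\lambda)$ allows all positive integers). $\mathrm{wt}(T)=x_1^{m_1}x_2^{m_2}\cdots$ with $m_j$ the number of occurrences of $j$ (with multiplicity); a weight $x_1^{\mu_1}x_2^{\mu_2}\cdots$ is identified with the sequence $\mu$. $|T|=\sum m_j$ and $|\lambda|$ is the number of boxes of $\lambda$. Reading word: for a column $C$, $\mathrm{rd}(C)$ first reads the smallest entry of each box, boxes from bottom to top, then the remaining entries of each box (one copy of its minimum removed) from smallest to largest, boxes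 from top to bottom; $\mathrm{rd}(T)=\mathrm{rd}(C_1)\cdots\mathrm{rd}(C_k)$, columns left to right. For $i\in\{1,\dots,n-1\}$, write $+$ for each letter $i$, $-$ for each letter $i+1$ of $\mathrm{rd}(T)$, cancel pairs $-+$ successively until $+\cdots+-\cdots-$ remains. $e_iT$: $0$ if no uncanceled $-$; else with $\mathsf b$ the box of the leftmost uncanceled $-$: if the box immediately above $\mathsf b$ contains $i$, remove an $i+1$ from $\mathsf b$ and add $i$ to the box above, otherwise replace that $i+1$ in $\mathsf b$ by $i$. $f_iT$: $0$ if no uncanceled $+$; else with $\mathsf b$ the box of the rightmost uncanceled $+$: if the box immediately below $\mathsf b$ contains $i+1$, remove the $i$ from $\mathsf b$ and add $i+1$ to the box below, otherwise replace that $i$ in $\mathsf b$ by $i+1$. $B(\mu)$ is the $U_q(\mathfrak{sl}_n)$-highest weight crystal of highest weight $\mu$ (semistandard Young tableaux of shape $\mu$, entries in $\{1,\dots,n\}$, standard crystal operators); $\cong$ is crystal isomorphism; $\bigoplus$ is disjoint union of crystals and $B^{\oplus m}$ is $m$ disjoint copies. The weak symmetric Grothendieck function is $\overline{G}_\lambda(\mathbf x;\alpha)=\sum_{T\in\mathrm{MVT}^\infty(\lambda)}\alpha^{|T|-|\lambda|}\mathrm{wt}(T)$ in variables $\mathbf x=(x_1,x_2,\dots)$, and $s_\mu$ is the Schur function.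
   Formalization: The expansion of the weak symmetric Grothendieck function is stated only when λ has at most n rows; for fewer variables MVT^n(λ) is empty, all multiplicities vanish and the identity fails (e.g. n=2, λ=(1,1,1)). *)

(* Defs.v *)
From mathcomp Require Import all_boot all_order all_algebra.
From mathcomp Require Import finmap multiset.
From mathcomp Require Import mathcomp_extra boolp classical_sets functions.
From mathcomp Require Import cardinality fsbigop.

Set Implicit Arguments.
Unset Strict Implicit.
Unset Printing Implicit Defensive.

Import GRing.Theory.

Local Open Scope classical_set_scope.
Local Open Scope nat_scope.

(** Letters are the positive integers; rows and columns are numbered from 0,
    so [(r, c)] is the box in row [r.+1] and column [c.+1]. *)

Definition is_partition (la : seq nat) : Prop := sorted geq la /\ 0 \notin la.

Definition part_incl (la mu : seq nat) : Prop :=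
  forall r, nth 0 la r <= nth 0 mu r.

(** A weight x_1^{m_1} x_2^{m_2} ... is the finitely supported function [m],
    [m j] being the exponent of x_j; the weights of tableaux have [m 0 = 0]. *)

Definition weight := {mset nat}%mset.

Definition weight_is (m : weight) (mu : seq nat) : Prop :=
  forall j, m j = nth 0 (0 :: mu) j.

(** ** Signature rule *)

(** A letter together with the box from which it is read. *)
Definition letter := (nat * (nat * nat))%type.

(** [st] is the stack of letters not yet cancelled, most recent first: an [i]
    cancels with an [i.+1] that is on top of the stack. *)
Definition sig_push (i : nat) (st : seq letter) (x : letter) : seq letter :=
  if x.1 == i.+1 then x :: st
  else if x.1 == i then
    if st is y :: st' then if y.1 == i.+1 then st' else x :: st
    else [:: x]
  else st.

Definition signature (i : nat) (w : seq letter) : seq letter :=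
  rev (foldl (sig_push i) [::] w).

Definition leftmost_minus (i : nat) (w : seq letter) : option (nat * nat) :=
  ohead [seq x.2 | x <- signature i w & x.1 == i.+1].

Definition rightmost_plus (i : nat) (w : seq letter) : option (nat * nat) :=
  ohead (rev [seq x.2 | x <- signature i w & x.1 == i]).

Definition column (sh : seq nat) (c : nat) : seq (nat * nat) :=
  [seq (r, c) | r <- iota 0 (size sh) & c < nth 0 sh r].

(** ** Multiset-valued tableaux *)

(** A tableau is the list of its rows.  A finite multiset of letters is encoded
    by its weakly increasing list of elements, so that its minimum and maximum
    are the first and last elements of the list. *)
Definition mvtab := seq (seq (seq nat)).

Definition box (T : mvtab) (p : nat * nat) : seq nat :=
  nth [::] (nth [::] T p.1) p.2.

Definition set_box (T : mvtab) (p : nat * nat) (b : seq nat) : mvtab :=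
  set_nth [::] T p.1 (set_nth [::] (nth [::] T p.1) p.2 b).

Definition mv_letters (T : mvtab) : seq nat := flatten (flatten T).

Definition mv_wt (T : mvtab) : weight := seq_mset (mv_letters T).

Definition MVT_inf (la : seq nat) : set mvtab :=
  [set T | [/\ shape T = la,
    forall r c, c < nth 0 la r ->
      [/\ box T (r, c) <> [::], sorted leq (box T (r, c))
        & {in box T (r, c), forall x, 0 < x}],
    forall r c, c.+1 < nth 0 la r ->
      last 0 (box T (r, c)) <= head 0 (box T (r, c.+1))
  & forall r c, c < nth 0 la r.+1 ->
      last 0 (box T (r, c)) < head 0 (box T (r.+1, c))]].

Definition MVT (n : nat) (la : seq nat) : set mvtab :=
  [set T | MVT_inf la T /\ {in mv_letters T, forall x, x <= n}].

Definition mv_rd_col (T : mvtab) (c : nat) : seq letter :=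
  let C := column (shape T) c in
  [seq (head 0 (box T p), p) | p <- rev C] ++
  [seq (x, p) | p <- C, x <- behead (box T p)].

Definition mv_rd (T : mvtab) : seq letter :=
  flatten [seq mv_rd_col T c | c <- iota 0 (head 0 (shape T))].

Definition mset_add (x : nat) (b : seq nat) : seq nat := sort leq (x :: b).

Definition mv_e (i : nat) (T : mvtab) : option mvtab :=
  if leftmost_minus i (mv_rd T) is Some (r, c) then
    let b := rem i.+1 (box T (r, c)) in
    let a := box T (r.-1, c) in
    Some (if (0 < r) && (i \in a)
          then set_box (set_box T (r, c) b) (r.-1, c) (mset_add i a)
          else set_box T (r, c) (mset_add i b))
  else None.

Definition mv_f (i : nat) (T : mvtab) : option mvtab :=
  if rightmost_plus i (mv_rd T) is Some (r, c) then
    let b := rem i (box T (r, c)) in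
    let d := box T (r.+1, c) in
    Some (if i.+1 \in d
          then set_box (set_box T (r, c) b) (r.+1, c) (mset_add i.+1 d)
          else set_box T (r, c) (mset_add i.+1 b))
  else None.

(** ** Semistandard Young tableaux *)

Definition tab := seq (seq nat).

Definition entry (t : tab) (p : nat * nat) : nat := nth 0 (nth [::] t p.1) p.2.

Definition set_entry (t : tab) (p : nat * nat) (x : nat) : tab :=
  set_nth [::] t p.1 (set_nth 0 (nth [::] t p.1) p.2 x).

Definition tab_wt (t : tab) : weight := seq_mset (flatten t).

Definition SSYT_inf (mu : seq nat) : set tab :=
  [set t | [/\ shape t = mu,
    forall r c, c < nth 0 mu r -> 0 < entry t (r, c),
    forall r c, c.+1 < nth 0 mu r -> entry t (r, c) <= entry t (r, c.+1)
  & forall r c, c < nth 0 mu r.+1 -> entry t (r, c) < entry t (r.+1, c)]].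

Definition SSYT (n : nat) (mu : seq nat) : set tab :=
  [set t | SSYT_inf mu t /\ {in flatten t, forall x, x <= n}].

Definition tab_rd (t : tab) : seq letter :=
  flatten [seq [seq (entry t p, p) | p <- rev (column (shape t) c)]
          | c <- iota 0 (head 0 (shape t))].

Definition tab_e (i : nat) (t : tab) : option tab :=
  omap (fun p => set_entry t p i) (leftmost_minus i (tab_rd t)).

Definition tab_f (i : nat) (t : tab) : option tab :=
  omap (fun p => set_entry t p i.+1) (rightmost_plus i (tab_rd t)).

(** ** Crystals *)

(** The underlying set of a crystal is [cr_set]; [None] stands for the element
    0.  The operators are defined on the whole ambient type [cr_sort], and that
    they preserve [cr_set] is part of [crystal_iso].  The functions eps_i and
    phi_i are max{k : e_i^k b <> 0} and max{k : f_i^k b <> 0}; being determined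
    by e_i and f_i, they are not recorded. *)
Record crystal := Crystal {
  cr_sort : Type;
  cr_set : set cr_sort;
  cr_wt : cr_sort -> weight;
  cr_e : nat -> cr_sort -> option cr_sort;
  cr_f : nat -> cr_sort -> option cr_sort }.

Arguments cr_set : clear implicits.

Definition cr_stable (n : nat) (B : crystal) : Prop :=
  forall i b b', 0 < i < n -> cr_set B b ->
    cr_e i b = Some b' \/ cr_f i b = Some b' -> cr_set B b'.

Definition crystal_iso (n : nat) (A B : crystal) : Prop :=
  [/\ cr_stable n A, cr_stable n B &
   exists psi : cr_sort A -> cr_sort B,
   [/\ set_bij (cr_set A) (cr_set B) psi,
       forall a, cr_set A a -> cr_wt (psi a) = cr_wt a,
       forall i a, 0 < i < n -> cr_set A a ->
         cr_e i (psi a) = omap psi (cr_e i a)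
     & forall i a, 0 < i < n -> cr_set A a ->
         cr_f i (psi a) = omap psi (cr_f i a)]].

Inductive generated (n : nat) (B : crystal) (b0 : cr_sort B) :
    cr_sort B -> Prop :=
  | Generated0 : generated n b0 b0
  | GeneratedE i b b' : 0 < i < n -> generated n b0 b ->
      cr_e i b = Some b' -> generated n b0 b'
  | GeneratedF i b b' : 0 < i < n -> generated n b0 b ->
      cr_f i b = Some b' -> generated n b0 b'.

Definition cr_closure (n : nat) (B : crystal) (b0 : cr_sort B) : crystal :=
  Crystal (generated n b0) (@cr_wt B) (@cr_e B) (@cr_f B).

Definition cr_sum (I : Type) (D : set I) (B : I -> crystal) : crystal :=
  @Crystal {i : I & cr_sort (B i)}
    [set x | D (tag x) /\ cr_set (B (tag x)) (tagged x)]
    (fun x => cr_wt (tagged x))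
    (fun i x => omap (Tagged (fun j => cr_sort (B j))) (cr_e i (tagged x)))
    (fun i x => omap (Tagged (fun j => cr_sort (B j))) (cr_f i (tagged x))).

Definition cr_copies (m : nat) (B : crystal) : crystal :=
  cr_sum [set k | k < m] (fun=> B).

Definition MVT_crystal (n : nat) (la : seq nat) : crystal :=
  Crystal (MVT n la) mv_wt mv_e mv_f.

Definition hw_crystal (n : nat) (mu : seq nat) : crystal :=
  Crystal (SSYT n mu) tab_wt tab_e tab_f.

Definition highest_weight (n : nat) (B : crystal) (b : cr_sort B) : Prop :=
  cr_set B b /\ forall i, 0 < i < n -> cr_e i b = None.

(** The number [M_la^mu]; the set is finite by [hw_mult_finite]. *)
Definition hw_mult (n : nat) (la mu : seq nat) : nat :=
  #|` fset_set [set T : mvtab |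
      @highest_weight n (MVT_crystal n la) T /\ weight_is (mv_wt T) mu]|%fset.

(** ** Formal power series in x_1, x_2, ... over Z[alpha] *)

(** A series is its coefficient function; alpha is the indeterminate ['X]. *)
Definition mseries := weight -> {poly int}%R.

Definition monom (a : {poly int}) (w : weight) : mseries :=
  fun m => if m == w then a else 0%R.

Definition locally_finite (I : Type) (D : set I) (F : I -> mseries) : Prop :=
  forall m, finite_set [set i | D i /\ F i m != 0%R].

(** Coefficientwise sum, meaningful for locally finite families. *)
Definition series_sum (I : choiceType) (D : set I) (F : I -> mseries) : mseries :=
  fun m => (\sum_(i \in D) F i m)%R.

Definition wgroth_term (la : seq nat) (T : mvtab) : mseries :=
  monom 'X^(size (mv_letters T) - sumn la) (mv_wt T).

Definition wgroth (la : seq nat) : mseries :=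
  series_sum (MVT_inf la) (wgroth_term la).

Definition schur_term (t : tab) : mseries := monom 1%R (tab_wt t).

Definition schur (mu : seq nat) : mseries := series_sum (SSYT_inf mu) schur_term.

Lemma finite_tab (mu : seq nat) (m : weight) :
  finite_set [set t : tab | shape t = mu /\ tab_wt t = m].
Proof.
apply: (@sub_finite_set _ _ (reshape mu @` [set` permutations (enum_mset m)])).
  move=> t /= [tmu tm]; exists (flatten t); last by rewrite -tmu flattenK.
  by rewrite /= mem_permutations -tm perm_sym perm_eq_seq_mset.
exact/finite_image/finite_seq.
Qed.

Lemma finite_mvtab (la : seq nat) (m : weight) :
  finite_set [set T : mvtab | shape T = la /\ mv_wt T = m].
Proof.
pose N := (size (enum_mset m)).+1.
pose g (u : (sumn la).-tuple 'I_N) :=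
  reshape la @` [set s | shape s = map val u /\ tab_wt s = m].
apply: (@sub_finite_set _ _ (\bigcup_(u in setT) g u)); last first.
  apply: bigcup_finite => [|u _]; first exact: finite_finset.
  exact/finite_image/finite_tab.
move=> T [Tla Tm].
have szl : size (map (fun k => inord k : 'I_N) (shape (flatten T))) == sumn la.
  by rewrite !size_map size_flatten Tla.
exists (Tuple szl) => //; exists (flatten T); last by rewrite -Tla flattenK.
split=> //=; rewrite -map_comp -[LHS]map_id; apply/eq_in_map => k kT /=.
rewrite inordK // ltnS -Tm (perm_size (perm_eq_seq_mset _)) size_flatten.
elim: (shape (flatten T)) kT => //= a s IH; rewrite inE => /orP[/eqP->|/IH].
  exact: leq_addr.
by move/leq_trans; apply; apply: leq_addl.
Qed.

Lemma wgroth_locally_finite (la : seq nat) :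
  locally_finite (MVT_inf la) (wgroth_term la).
Proof.
move=> m; apply: sub_finite_set (finite_mvtab la m) => T [[Tla _ _ _]].
by rewrite /wgroth_term /monom; have [->|_] := eqVneq m (mv_wt T); rewrite ?eqxx.
Qed.

Lemma schur_locally_finite (mu : seq nat) :
  locally_finite (SSYT_inf mu) schur_term.
Proof.
move=> m; apply: sub_finite_set (finite_tab mu m) => t [[tmu _ _ _]].
by rewrite /schur_term /monom; have [->|_] := eqVneq m (tab_wt t); rewrite ?eqxx.
Qed.

Lemma hw_mult_finite (n : nat) (la mu : seq nat) :
  finite_set [set T : mvtab |
    @highest_weight n (MVT_crystal n la) T /\ weight_is (mv_wt T) mu].
Proof.
have [[T0 [_ T0mu]]|no] :=
  pselect (exists T0 : mvtab, @highest_weight n (MVT_crystal n la) T0 /\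
                              weight_is (mv_wt T0) mu); last first.
  apply: sub_finite_set (finite_set0 _) => T TP.
  by case: no; exists T.
apply: sub_finite_set (finite_mvtab la (mv_wt T0)) => T [[[[Tla _ _ _] _] _] Tmu].
by split=> //; apply/msetP => j; rewrite Tmu T0mu.
Qed.

(* Main.v *)
Require Import Defs.
From mathcomp Require Import all_boot all_order all_algebra.
From mathcomp Require Import finmap multiset.
From mathcomp Require Import mathcomp_extra boolp classical_sets functions.
From mathcomp Require Import cardinality fsbigop.
From mathcomp Require Import zify.

Set Implicit Arguments.
Unset Strict Implicit.
Unset Printing Implicit Defensive.

Local Open Scope classical_set_scope.
Local Open Scope nat_scope.

(** The operators on multiset-valued tableaux act on reading words by the
    signature rule and keep every letter in its column, and the reading word
    together with the columns of its letters determines the tableau.  An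
    elementary Knuth move at a fixed position, extended by the identity, is an
    involution of the set of all words that commutes with the signature rule.
    By such moves every Yamanouchi word becomes a product of columns
    h ... 2 1 of weakly decreasing heights, which depends only on the weight;
    hence highest weight words of equal weight generate isomorphic components.
    Semistandard tableaux of shape mu are the multiset-valued tableaux of shape
    mu with one-letter boxes; they have a single highest weight element, of
    weight mu, so every component of weight mu is B(mu).

    In a highest weight tableau all letters of row r equal r.  So its weight is
    a partition containing lambda with as many parts as lambda, the
    multiplicities do not depend on n >= l(lambda), and the expansion of a
    coefficient of the weak Grothendieck function follows from the decomposition
    for n large. *)

(** The operators are specified on boxes, with two branches each, while the argument needs them to
    change one letter of the reading word in place. This works because the letters of a box other
    than its first are read immediately before those of the box below: a letter that changes box
    leaves the end of one block and becomes the beginning of the next. Configurations in which a box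
    would be emptied or a row inequality violated are excluded by the signature: there the letter
    would be cancelled, or would not be the extreme uncancelled one. Isomorphisms of single
    components cannot be concatenated, but bijections of all words that preserve length, [phi] and
    [eps] can, since the tensor product rule sees nothing else of the factors. Hence words are
    related by automorphisms of the whole set of words. No insertion algorithm is needed for the
    normal form; it is enough to move single letters past columns. *)

(** * The signature rule on words without boxes *)

(** Counts of the uncancelled [i] ([phi]) and [i.+1] ([eps]), by recursion from the left: a new
    [i.+1] in front cancels one uncancelled [i] on its right, if there is any. *)
Fixpoint phi (i : nat) (w : seq nat) : nat :=
  if w is x :: w' then
    if x == i.+1 then (phi i w').-1 else (x == i) + phi i w'
  else 0.

Fixpoint eps (i : nat) (w : seq nat) : nat :=
  if w is x :: w' then
    if x == i.+1 then (phi i w' == 0) + eps i w' else eps i w'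
  else 0.

(** Tensor product rule: uncancelled [i.+1] of [u] are matched with uncancelled [i] of [v], and
    truncated subtraction gives what survives. Both equations are proved together because the
    recursion of [eps] tests [phi]. *)
Lemma phi_eps_cat i u v :
  phi i (u ++ v) = phi i u + (phi i v - eps i u) /\
  eps i (u ++ v) = eps i v + (eps i u - phi i v).
Proof.
elim: u => [|x u [IHp IHe]] /=; first by lia.
rewrite IHp IHe; case: (x == i.+1); last by lia.
by case: eqP => ?; case: eqP => ?; lia.
Qed.

Lemma phi_cat i u v : phi i (u ++ v) = phi i u + (phi i v - eps i u).
Proof. by case: (phi_eps_cat i u v). Qed.

Lemma eps_cat i u v : eps i (u ++ v) = eps i v + (eps i u - phi i v).
Proof. by case: (phi_eps_cat i u v). Qed.

Lemma phi_notin i w : i \notin w -> phi i w = 0.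
Proof.
by elim: w => //= x w IH; rewrite inE negb_or eq_sym => /andP[/negPf-> /IH->]; case: ifP.
Qed.

Lemma eps_notin i w : i.+1 \notin w -> eps i w = 0.
Proof.
by elim: w => //= x w IH; rewrite inE negb_or eq_sym => /andP[/negPf-> /IH->].
Qed.

(** Each cancellation removes one [i] and one [i.+1], so the difference of their numbers is
    invariant. *)
Lemma phi_eps_count i w :
  phi i w + count_mem i.+1 w = eps i w + count_mem i w.
Proof.
elim: w => //= x w; case: (eqVneq x i.+1) => [->|]; last by lia.
by rewrite (gtn_eqF (ltnSn i)); case: eqP; lia.
Qed.

(* [f_i] and [e_i] are the two directions of this relation: the rightmost
   uncancelled [i] of [w] and the leftmost uncancelled [i.+1] of [w'] are at the
   same position. *)
Definition wordF (i : nat) (w w' : seq nat) : Prop :=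
  exists u v, [/\ w = u ++ i :: v, w' = u ++ i.+1 :: v, eps i u = 0
                & phi i v = 0].

Lemma wordF_phi i w w' : wordF i w w' -> 0 < phi i w.
Proof.
move=> [u [v [-> _ eu pv]]]; rewrite phi_cat eu /= eqxx (ltn_eqF (ltnSn i)).
by lia.
Qed.

Lemma wordF_eps i w w' : wordF i w w' -> 0 < eps i w'.
Proof.
move=> [u [v [_ -> eu pv]]]; rewrite eps_cat eu /= eqxx pv; lia.
Qed.

Lemma wordF_sum i w w' : wordF i w w' -> sumn w' = (sumn w).+1.
Proof. by move=> [u [v [-> -> _ _]]]; rewrite !sumn_cat /= addSn addnS. Qed.

Lemma wordF_size i w w' : wordF i w w' -> size w' = size w.
Proof. by move=> [u [v [-> -> _ _]]]; rewrite !size_cat. Qed.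

(** Computable form of [wordF], by which Knuth moves can be checked on three letters. The guard says
    that no uncancelled [i] of [w'] survives the letter [x] in front; only then can the operator act
    on [x] itself. *)
Fixpoint word_f (i : nat) (w : seq nat) : option (seq nat) :=
  if w is x :: w' then
    if phi i w' <= (x == i.+1) then
      if x == i then Some (i.+1 :: w') else None
    else omap (cons x) (word_f i w')
  else None.

Lemma wordF_word_f i w w' : wordF i w w' <-> word_f i w = Some w'.
Proof.
split.
  move=> [u [v [-> -> ]]]; elim: u => [|x u IH] /=.
    by move=> _ ->; rewrite eqxx.
  move=> eu pv; rewrite phi_cat /= eqxx (ltn_eqF (ltnSn i)) pv.
  move: eu; case: (eqVneq x i.+1) => [->|xi] eu; last first.
    by rewrite leqn0 addn_eq0 eu andbF /= IH.
  have [pu eu0] : 0 < phi i u /\ eps i u = 0 by move: eu; case: eqP; lia.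
  by rewrite eu0 subn0 addn0 addn1 ltnS leqNgt pu /= IH.
elim: w w' => //= x w IH w'; case: leqP => [|] pw.
  case: eqP => // xi [<-]; exists [::], w; rewrite xi; split=> //.
  by move: pw; rewrite xi (ltn_eqF (ltnSn i)); lia.
case E: (word_f i w) => [w1|] //= [<-].
have [u [v [ew ew1 eu pv]]] := IH _ E.
exists (x :: u), v; rewrite ew ew1; split=> //=; rewrite eu.
move: pw; rewrite ew phi_cat /= eqxx (ltn_eqF (ltnSn i)) pv eu.
by case: eqP => //; lia.
Qed.

Lemma wordF_fun i w w1 w2 : wordF i w w1 -> wordF i w w2 -> w1 = w2.
Proof. by move=> /wordF_word_f Ew /wordF_word_f; rewrite Ew => -[]. Qed.

Lemma cat_cons_split (A : Type) (u v x y : seq A) a : u ++ a :: v = x ++ y ->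
  (exists2 v1, x = u ++ a :: v1 & v = v1 ++ y) \/
  (exists2 u1, u = x ++ u1 & y = u1 ++ a :: v).
Proof.
elim: u x => [|b u IH] [|c x] /=.
- by move=> <-; right; exists [::].
- by move=> [-> ->]; left; exists x.
- by move=> <-; right; exists (b :: u).
- move=> [-> /IH[[v1 -> ->]|[u1 -> ->]]]; [left|right].
    by exists v1.
  by exists u1.
Qed.

(** Tensor product rule for [f_i]: it acts on the left factor unless an uncancelled [i] of [y]
    survives the uncancelled [i.+1] of [x]. *)
Lemma wordF_cat i x y w :
  wordF i (x ++ y) w <->
  (phi i y <= eps i x /\ exists2 x', wordF i x x' & w = x' ++ y) \/
  (eps i x < phi i y /\ exists2 y', wordF i y y' & w = x ++ y').
Proof.
split=> [[u [v [/esym E -> eu pv]]]|].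
  have [[v1 ex ev]|[u1 ex ev]] := cat_cons_split E; subst.
- left; move: pv; rewrite phi_cat => pv.
  rewrite eps_cat eu /= (ltn_eqF (ltnSn i)); split; first by lia.
  exists (u ++ i.+1 :: v1); last by rewrite -catA.
  by exists u, v1; split=> //; lia.
- right; move: eu; rewrite eps_cat => eu.
  rewrite phi_cat /= eqxx (ltn_eqF (ltnSn i)) pv; split; first by lia.
  exists (u1 ++ i.+1 :: v); last by rewrite catA.
  by exists u1, v; split=> //; lia.
move=> [[le [x' [u [v [ex -> eu pv]]] ->]]|[lt [y' [u [v [ey -> eu pv]]] ->]]].
  exists u, (v ++ y); rewrite ex -!catA; split=> //; rewrite phi_cat pv.
  move: le; rewrite ex eps_cat eu /= (ltn_eqF (ltnSn i)); lia.
exists (x ++ u), v; rewrite ey -!catA; split=> //; rewrite eps_cat eu.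
by move: lt; rewrite ey phi_cat eu /= eqxx (ltn_eqF (ltnSn i)) pv; lia.
Qed.

(* The Knuth relations xzy ~ zxy (x <= y < z) and yxz ~ yzx (x < y <= z), each
   read in both directions. *)
Definition knuth3 (w : seq nat) : seq nat :=
  if w is [:: a; b; c] then
    if (a <= c < b) || (b <= c < a) then [:: b; a; c]
    else if (c < a <= b) || (b < a <= c) then [:: a; c; b]
    else w
  else w.

Lemma knuth3K : involutive knuth3.
Proof.
move=> [|a [|b [|c [|d w]]]] //=.
by do ?[case: ifP => /= ?]; rewrite //; lia.
Qed.

Lemma perm_knuth3 w : perm_eq (knuth3 w) w.
Proof.
case: w => [|a [|b [|c [|d w]]]] //=.
by do ?[case: ifP => _] => //; apply/permP => p /=; lia.
Qed.

Lemma phi_knuth3 i w : phi i (knuth3 w) = phi i w.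
Proof.
case: w => [|a [|b [|c [|d w]]]] //=.
do ?[case: ifP => /= ?]; do ?case: eqP => /= ?; lia.
Qed.

Lemma eps_knuth3 i w : eps i (knuth3 w) = eps i w.
Proof.
have := phi_eps_count i w; have := phi_eps_count i (knuth3 w).
by rewrite phi_knuth3 !(permP (perm_knuth3 w)); lia.
Qed.

(** After [f_i] a Knuth move is again possible, but it may be of the other type: [i, i+1, i] becomes
    [i+1, i+1, i]. This is why one map contains both relations. *)
Lemma word_f_knuth3 i w : word_f i (knuth3 w) = omap knuth3 (word_f i w).
Proof.
case: w => [|a [|b [|c [|d w]]]]; try by [].
- by rewrite /=; do ?case: ifP => //=.
- by rewrite /=; do ?case: ifP => //=.
- have si : (i.+1 == i) = false by lia.
  have is_ : (i == i.+1) = false by lia.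
  pose cond1 := (a <= c < b) || (b <= c < a).
  pose cond2 := (c < a <= b) || (b < a <= c).
  have k3 : knuth3 [:: a; b; c] = if cond1 then [:: b; a; c] else
     if cond2 then [:: a; c; b] else [:: a; b; c] by [].
  rewrite k3 {k3}; case E1: cond1; [|case E2: cond2]; move: E1; try (move: E2);
  rewrite {}/cond1 {}/cond2;
  (case: (eqVneq a i.+1) => [->|/negPf a1]; [|case: (eqVneq a i) => [->|/negPf a0]]);
  (case: (eqVneq b i.+1) => [->|/negPf b1]; [|case: (eqVneq b i) => [->|/negPf b0]]);
  (case: (eqVneq c i.+1) => [->|/negPf c1]; [|case: (eqVneq c i) => [->|/negPf c0]]);
  intros; try (exfalso; lia);
  do 3 (simpl; rewrite ?eqxx;
    repeat match goal with
      H : (?x == ?y) = false |- context [?x == ?y] => rewrite H end);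
  try by [].
  all: repeat (case: ifP => ?); try by [].
  all: try (exfalso; lia).
- rewrite [knuth3 _]/=; case E: (word_f i _) => [w1|] //=.
  have /wordF_word_f/wordF_size := E.
  by case: w1 {E} => [|? [|? [|? [|? ?]]]].
Qed.

(** * Words up to automorphisms of the crystal of all words *)

Definition word_morphism (P : seq nat -> seq nat) : Prop :=
  [/\ forall i w w', wordF i w w' -> wordF i (P w) (P w'),
      forall i w, phi i (P w) = phi i w, forall i w, eps i (P w) = eps i w
    & forall w, perm_eq (P w) w].

(* The two words correspond under an automorphism of the crystal of all words;
   so their components are isomorphic. *)
Definition plactic (w w' : seq nat) : Prop :=
  exists P Q, [/\ cancel P Q, cancel Q P, word_morphism P, word_morphism Q
                & P w = w'].

Lemma word_morphism_id : word_morphism id.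
Proof. by split. Qed.

Lemma word_morphism_comp P Q :
  word_morphism P -> word_morphism Q -> word_morphism (P \o Q).
Proof.
move=> [PF Pp Pe Ps] [QF Qp Qe Qs]; split=> [i w w' /QF /PF //|i w|i w|w] /=.
- by rewrite Pp Qp.
- by rewrite Pe Qe.
- exact: perm_trans (Ps _) (Qs _).
Qed.

Lemma plactic_refl w : plactic w w.
Proof. by exists id, id; split=> //; exact: word_morphism_id. Qed.

Lemma plactic_sym w w' : plactic w w' -> plactic w' w.
Proof. by move=> [P [Q [PK QK mP mQ <-]]]; exists Q, P; split. Qed.

Lemma plactic_trans w2 w1 w3 : plactic w1 w2 -> plactic w2 w3 -> plactic w1 w3.
Proof.
move=> [P [Q [PK QK mP mQ <-]]] [P' [Q' [PK' QK' mP' mQ' <-]]].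
exists (P' \o P), (Q \o Q'); split=> //; try exact: can_comp;
  exact: word_morphism_comp.
Qed.

(** The cut is at a fixed position, so that the map is defined on all words; in a word shorter than
    [k] the second part is empty. As the parts keep their lengths, the inverse cuts at the same
    place. *)
Definition cat_map k (P Q : seq nat -> seq nat) (w : seq nat) : seq nat :=
  P (take k w) ++ Q (drop k w).

Lemma cat_map_cat k P Q (w u v : seq nat) :
  size u = size (take k w) -> size v = size (drop k w) ->
  cat_map k P Q (u ++ v) = P u ++ Q v.
Proof.
rewrite size_take_min size_drop /cat_map => su sv.
have [le|lt] := leqP k (size w).
  have uk : size u = k by rewrite su; lia.
  by rewrite take_size_cat // drop_size_cat.
have -> : v = [::] by apply: size0nil; lia.
by rewrite cats0 take_oversize ?drop_oversize //; lia.
Qed.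

Lemma cat_map_can k P Q P' Q' : cancel P P' -> cancel Q Q' ->
  word_morphism P -> word_morphism Q ->
  cancel (cat_map k P Q) (cat_map k P' Q').
Proof.
move=> PK QK [_ _ _ Ps] [_ _ _ Qs] w; rewrite {2}/cat_map.
rewrite (@cat_map_cat _ _ _ w) ?PK ?QK ?cat_take_drop //.
  exact/perm_size/Ps.
exact/perm_size/Qs.
Qed.

(** The branch of the tensor product rule depends only on [eps] of the left part and [phi] of the
    right one, and both are preserved. *)
Lemma word_morphism_cat_map k P Q :
  word_morphism P -> word_morphism Q -> word_morphism (cat_map k P Q).
Proof.
move=> [PF Pp Pe Ps] [QF Qp Qe Qs]; split.
- move=> i w w'; rewrite -{1}(cat_take_drop k w) => /wordF_cat H.
  apply/wordF_cat; rewrite Qp Pe; case: H => -[le [x Fx ->]]; [left|right].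
    split=> //; exists (P x); first exact: PF.
    by apply: cat_map_cat; rewrite ?(wordF_size Fx).
  split=> //; exists (Q x); first exact: QF.
  by apply: cat_map_cat; rewrite ?(wordF_size Fx).
- by move=> i w; rewrite -{2}(cat_take_drop k w) !phi_cat Pp Pe Qp.
- by move=> i w; rewrite -{2}(cat_take_drop k w) !eps_cat Qe Pe Qp.
- by move=> w; rewrite -{2}(cat_take_drop k w) perm_cat.
Qed.

Lemma plactic_cat u u' v v' :
  plactic u u' -> plactic v v' -> plactic (u ++ v) (u' ++ v').
Proof.
move=> [P [P' [PK PK' mP mP' <-]]] [Q [Q' [QK QK' mQ mQ' <-]]].
exists (cat_map (size u) P Q), (cat_map (size u) P' Q').
split; try exact: cat_map_can; try exact: word_morphism_cat_map.
by rewrite /cat_map take_size_cat // drop_size_cat.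
Qed.

Lemma plactic_cons x u u' : plactic u u' -> plactic (x :: u) (x :: u').
Proof. exact: plactic_cat (plactic_refl [:: x]). Qed.

Lemma plactic_knuth3 w : plactic w (knuth3 w).
Proof.
have mk : word_morphism knuth3.
  split; [|exact: phi_knuth3|exact: eps_knuth3|exact: perm_knuth3].
  by move=> i u u' /wordF_word_f Fu; apply/wordF_word_f; rewrite word_f_knuth3 Fu.
by exists knuth3, knuth3; split=> //; exact: knuth3K.
Qed.

(** * Yamanouchi words and their normal form *)

Fixpoint col_word (h : nat) : seq nat := if h is h'.+1 then h :: col_word h' else [::].

Lemma mem_col_word h x : (x \in col_word h) = (0 < x <= h).
Proof. by elim: h => [|h IH] /=; rewrite ?inE ?IH; lia. Qed.

(** The letter [x] passes the smaller letters one at a time. Each move needs on its left a pivot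
    that is greater than the letter passed and at most [x]; the preceding letter of the column is
    one. *)
Lemma plactic_col_word_tail h x : h < x ->
  plactic (h.+1 :: x :: col_word h) (col_word h.+1 ++ [:: x]).
Proof.
elim: h => [|h IH] hx; first exact: plactic_refl.
rewrite [col_word h.+2]/= cat_cons.
have -> : [:: h.+2, x & col_word h.+1] = [:: h.+2; x; h.+1] ++ col_word h by [].
apply: (plactic_trans (w2 := [:: h.+2; h.+1; x] ++ col_word h)).
  apply: plactic_cat (plactic_refl _).
  have -> : [:: h.+2; h.+1; x] = knuth3 [:: h.+2; x; h.+1].
    rewrite /knuth3 ifF ?ifT //; lia.
  exact: plactic_knuth3.
exact/plactic_cons/IH/ltnW.
Qed.

(** While the column begins above [x], its first letter is exchanged with [x], the second letter
    being the witness of the Knuth relation. Once it begins with [x], [plactic_col_word_tail]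
    applies. *)
Lemma plactic_col_word h x : 0 < x <= h ->
  plactic (x :: col_word h) (col_word h ++ [:: x]).
Proof.
elim: h => [|h IH] hx; first by lia.
have [->|xh] := eqVneq x h.+1; first exact: plactic_col_word_tail.
case: h IH hx xh => [|h] IH hx xh; first by lia.
have -> : x :: col_word h.+2 = [:: x; h.+2; h.+1] ++ col_word h by [].
apply: (plactic_trans (w2 := [:: h.+2; x; h.+1] ++ col_word h)).
  apply: plactic_cat (plactic_refl _).
  have -> : [:: h.+2; x; h.+1] = knuth3 [:: x; h.+2; h.+1].
    rewrite /knuth3 ifT //; lia.
  exact: plactic_knuth3.
by apply: plactic_cons; apply: IH; lia.
Qed.

(** Highest weight words, with no bound on [i]; equivalently, every suffix has at least as many [i]
    as [i.+1], for each positive [i]. *)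
Definition yamanouchi (w : seq nat) : Prop := forall i, 0 < i -> eps i w = 0.

Lemma yamanouchi_suffix u v : yamanouchi (u ++ v) -> yamanouchi v.
Proof. by move=> y i /y; rewrite eps_cat; lia. Qed.

Lemma yamanouchi_plactic u v : plactic u v -> yamanouchi u -> yamanouchi v.
Proof. by move=> [P [_ [_ _ [_ _ Pe _] _ <-]]] y i /y; rewrite Pe. Qed.

Lemma yamanouchi_pred x v : yamanouchi (x :: v) -> 1 < x -> x.-1 \in v.
Proof.
case: x => [|[|x]] // y _; have /= := y x.+1 isT; rewrite eqxx.
by case: (boolP (x.+1 \in v)) => // /phi_notin ->.
Qed.

Definition col_words (hs : seq nat) : seq nat := flatten (map col_word hs).

Lemma mem_col_words hs x :
  (x \in col_words hs) = (0 < x) && has (fun h => x <= h) hs.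
Proof.
elim: hs => [|h hs IH]; first by rewrite andbF.
by rewrite /col_words /= mem_cat mem_col_word IH; case: (0 < x).
Qed.

(* The letter [x] commutes with the columns of height at least [x]; by the
   lattice condition the next column has height [x.-1], and [x] extends it. *)
Lemma plactic_insert x hs : 0 < x -> sorted geq hs -> all (leq 1) hs ->
  yamanouchi (x :: col_words hs) ->
  exists hs', [/\ sorted geq hs', all (leq 1) hs'
                & plactic (x :: col_words hs) (col_words hs')].
Proof.
elim: hs => [|h hs IH] x0.
  move=> _ _ /yamanouchi_pred y; exists [:: 1]; split=> //.
  have -> : x = 1 by case: (ltngtP x 1) y => // [|_ /(_ isT)//]; lia.
  exact: plactic_refl.
have geqT : transitive geq by move=> a b c /= ab bc; exact: leq_trans bc ab.
rewrite [sorted _ _]/= path_sortedE // => /andP[hhs shs] /= /andP[h0 hs0] yx.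
have [xh|hx] := leqP x h.
  have pl : plactic (x :: col_word h ++ col_words hs) (col_word h ++ x :: col_words hs).
    rewrite -cat1s catA -[col_word h ++ _]/(col_word h ++ [:: x] ++ col_words hs) catA.
    by apply: plactic_cat (plactic_refl _); apply: plactic_col_word; rewrite x0.
  have /yamanouchi_suffix/(IH x0 shs hs0)[hs' [shs' hs'0 pl']] :=
    yamanouchi_plactic pl yx.
  exists (h :: hs'); split=> /=.
  (* A new height is a letter of the new word; since the weight is preserved, it is [x] or occurs in
     an old column, so it is at most [h]. *)
  - rewrite path_sortedE // shs' andbT; apply/allP => k khs' /=.
    have k0 : 0 < k by exact: (allP hs'0).
    have : k \in col_words hs'.
      by rewrite mem_col_words k0; apply/hasP; exists k.
    have [P [_ [_ _ [_ _ _ Ps] _ <-]]] := pl'.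
    rewrite (perm_mem (Ps _)) inE => /orP[/eqP-> //|].
    rewrite mem_col_words k0 /= => /hasP[k' /(allP hhs) /= k'h kk'].
    exact: leq_trans kk' k'h.
  - by rewrite h0.
  - exact: plactic_trans pl (plactic_cat (plactic_refl _) pl').
have := yamanouchi_pred yx (leq_ltn_trans h0 hx).
rewrite mem_col_words /= => /andP[_] xh.
have {xh hx} -> : x = h.+1.
  apply/eqP; rewrite eqn_leq hx andbT -(prednK x0) ltnS.
  case/orP: xh => // /hasP[k /(allP hhs) /= kh xk]; exact: leq_trans xk kh.
exists (h.+1 :: hs); split=> //=; last exact: plactic_refl.
  rewrite path_sortedE // shs andbT; apply/allP => k /(allP hhs) /=; exact: leqW.
Qed.

Lemma plactic_yamanouchi w : {in w, forall x, 0 < x} -> yamanouchi w ->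
  exists hs, [/\ sorted geq hs, all (leq 1) hs & plactic w (col_words hs)].
Proof.
elim: w => [|x w IH] w0 yw.
  by exists [::]; split=> //; exact: plactic_refl.
have w0' : {in w, forall y, 0 < y}.
  by move=> y yw'; apply: w0; rewrite inE yw' orbT.
have [hs [shs hs0 pl]] := IH w0' (@yamanouchi_suffix [:: x] _ yw).
have yx := yamanouchi_plactic (plactic_cons x pl) yw.
have [hs' [shs' hs'0 pl']] := plactic_insert (w0 _ (mem_head x w)) shs hs0 yx.
by exists hs'; split=> //; exact: plactic_trans (plactic_cons x pl) pl'.
Qed.

(** The largest letter is the first height; remove that column and repeat. The heights form the
    conjugate of the weight. *)
Lemma col_words_perm_inj hs hs' : sorted geq hs -> sorted geq hs' ->
  all (leq 1) hs -> all (leq 1) hs' -> perm_eq (col_words hs) (col_words hs') ->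
  hs = hs'.
Proof.
have geqT : transitive geq by move=> a b c /= ab bc; exact: leq_trans bc ab.
have max h s t : 0 < h -> path geq t s -> h \in col_words (t :: s) -> h <= t.
  move=> h0; rewrite path_sortedE // mem_col_words => /andP[/allP st _] /andP[_] /=.
  by case/orP=> // /hasP[k /st /= kt hk]; exact: leq_trans hk kt.
have hd h s : 0 < h -> h \in col_words (h :: s).
  by move=> h0; rewrite mem_col_words h0 /= leqnn.
elim: hs hs' => [|h hs IH] [|h' hs'] //=.
- by move=> _ _ _ /andP[h0 _] /perm_mem/(_ h'); rewrite hd.
- by move=> _ _ /andP[h0 _] _ /perm_mem/(_ h); rewrite hd.
move=> phs phs' /andP[h0 hs0] /andP[h'0 hs'0] pe.
have ehh : h = h'.
  apply/eqP; rewrite eqn_leq (max h hs' h') ?(max h' hs h) //.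
    by rewrite (perm_mem pe) hd.
  by rewrite -(perm_mem pe) hd.
subst h'; congr cons; apply: IH => //; try exact: path_sorted phs.
  exact: path_sorted phs'.
by move: pe; rewrite /col_words /= perm_cat2l.
Qed.

Theorem plactic_perm_yamanouchi u v :
  {in u, forall x, 0 < x} -> yamanouchi u -> yamanouchi v -> perm_eq u v ->
  plactic u v.
Proof.
move=> u0 yu yv puv.
have v0 : {in v, forall x, 0 < x} by move=> x; rewrite -(perm_mem puv) => /u0.
have [hs [shs hs0 pl]] := plactic_yamanouchi u0 yu.
have [hs' [shs' hs'0 pl']] := plactic_yamanouchi v0 yv.
have ehs : hs = hs'.
  have [P [_ [_ _ [_ _ _ Ps] _ eP]]] := pl.
  have [P' [_ [_ _ [_ _ _ Ps'] _ eP']]] := pl'.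
  apply: col_words_perm_inj => //; rewrite -eP -eP'.
  by rewrite (perm_trans (Ps u)) // (perm_trans puv) // perm_sym.
by apply: plactic_trans pl (plactic_sym _); rewrite ehs.
Qed.

(** * Boxes of the uncancelled letters *)

Definition word_of (w : seq letter) : seq nat := [seq x.1 | x <- w].

(** On the stack the uncancelled [i.+1] ([M]) lie above the uncancelled [i] ([P]). The last two
    clauses locate the only letters that the operators use, the top of [P] and the bottom of [M], by
    splittings as in [wordF]. *)
Lemma sig_stackP i w : exists M P,
  [/\ foldl (sig_push i) [::] w = M ++ P,
      all (fun x => x.1 == i.+1) M /\ all (fun x => x.1 == i) P,
      size M = eps i (word_of w) /\ size P = phi i (word_of w),
      forall p P', P = (i, p) :: P' -> exists u v,
        [/\ w = u ++ (i, p) :: v, eps i (word_of u) = 0 & phi i (word_of v) = 0]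
    & forall p M', M = rcons M' (i.+1, p) -> exists u v,
        [/\ w = u ++ (i.+1, p) :: v, eps i (word_of u) = 0 & phi i (word_of v) = 0]].
Proof.
elim/last_ind: w => [|w [x q] [M [P [ew [aM aP] [sM sP] dP dM]]]].
  by exists [::], [::]; split=> //= p [].
have ii : (i == i.+1) = false by lia.
rewrite foldl_rcons {}ew /sig_push [(x, q).1]/=.
have wdr (v : seq letter) : word_of (rcons v (x, q)) = word_of v ++ [:: x].
  by rewrite /word_of map_rcons -cats1.
have [xi|xi] := eqVneq x i.+1.
  exists ((x, q) :: M), P; rewrite wdr phi_cat eps_cat /= xi eqxx.
  split=> //.
  - by split=> //; lia.
  - move=> p P' /dP[u [v [-> eu pv]]]; exists u, (rcons v (x, q)).
    by rewrite rcons_cat wdr phi_cat pv /= xi eqxx; split.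
  move=> p [|y M'] /=.
    by move=> [qp M0]; exists w, [::]; rewrite -qp -cats1 -sM M0.
  move=> [_] /dM[u [v [-> eu pv]]]; exists u, (rcons v (x, q)).
  by rewrite rcons_cat wdr phi_cat pv /= xi eqxx; split.
have [xi'|xi'] := eqVneq x i; last first.
  exists M, P; rewrite wdr phi_cat eps_cat /= (negPf xi) (negPf xi').
  split=> //; first by lia.
    move=> p P' /dP[u [v [-> eu pv]]]; exists u, (rcons v (x, q)).
    by rewrite rcons_cat wdr phi_cat pv /= (negPf xi) (negPf xi'); split.
  move=> p M' /dM[u [v [-> eu pv]]]; exists u, (rcons v (x, q)).
  by rewrite rcons_cat wdr phi_cat pv /= (negPf xi) (negPf xi'); split.
subst x; case: M aM sM dM => [|y M] /= aM sM dM.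
  exists [::], ((i, q) :: P); rewrite wdr phi_cat eps_cat /= ii eqxx.
  split=> //.
  - by case: P aP sP dP => //= y P /andP[/eqP-> _]; rewrite ii.
  - by split; lia.
  - by move=> p P' [-> _]; exists w, [::]; rewrite -cats1 -sM.
  - by move=> p [].
case/andP: aM => yi aM; rewrite yi.
exists M, P; rewrite wdr phi_cat eps_cat /= ii eqxx; split=> //.
- by split; lia.
- move=> p P' eP; have [u [v [ew eu pv]]] := dP p P' eP.
  exists u, (rcons v (i, q)); rewrite ew rcons_cat wdr; split=> //.
  (* The stack had an [i.+1] on top, so [v] has an uncancelled [i.+1] that absorbs the new [i]. *)
  move: sM; rewrite ew /word_of map_cat eps_cat eu /= ii -/(word_of v) => sM.
  by rewrite phi_cat pv /= ii eqxx; lia.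
- move=> p M' eM; have [|u [v [ew eu pv]]] := dM p (y :: M'); first by rewrite eM.
  exists u, (rcons v (i, q)); rewrite ew rcons_cat wdr; split=> //.
  move: sM; rewrite ew /word_of map_cat eps_cat eu /= eqxx -/(word_of v) pv eM size_rcons.
  by rewrite phi_cat pv /= ii eqxx; lia.
Qed.

Lemma rightmost_plusP i w :
  if rightmost_plus i w is Some p then
    exists u v, [/\ w = u ++ (i, p) :: v, eps i (word_of u) = 0 & phi i (word_of v) = 0]
  else phi i (word_of w) = 0.
Proof.
have [M [P [ew [aM aP] [sM sP] dP _]]] := sig_stackP i w.
have -> : rightmost_plus i w = ohead [seq x.2 | x <- P].
  rewrite /rightmost_plus /signature ew rev_cat filter_cat.
  rewrite (all_filterP _) ?all_rev // (_ : filter _ (rev M) = [::]) ?cats0.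
    by rewrite -map_rev revK.
  apply/eqP; rewrite -size_eq0 size_filter -leqn0 leqNgt -has_count.
  rewrite has_rev; apply/hasPn => x /(allP aM)/eqP->; lia.
case: P {aM sM} aP sP dP {ew} => [|[x p] P] //= /andP[/eqP/= -> _] _.
by move/(_ _ _ erefl).
Qed.

Lemma leftmost_minusP i w :
  if leftmost_minus i w is Some p then
    exists u v, [/\ w = u ++ (i.+1, p) :: v, eps i (word_of u) = 0
                  & phi i (word_of v) = 0]
  else eps i (word_of w) = 0.
Proof.
have [M [P [ew [aM aP] [sM sP] _ dM]]] := sig_stackP i w.
have -> : leftmost_minus i w = ohead [seq x.2 | x <- rev M].
  rewrite /leftmost_minus /signature ew rev_cat filter_cat.
  rewrite [X in _ ++ X](all_filterP _) ?all_rev //.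
  rewrite (_ : filter _ (rev P) = [::]) //.
  apply/eqP; rewrite -size_eq0 size_filter -leqn0 leqNgt -has_count.
  rewrite has_rev; apply/hasPn => x /(allP aP)/eqP->; lia.
case/lastP: M aM sM dM {ew} => [|M [x p]] //=.
rewrite all_rcons rev_rcons /= => /andP[/eqP/= -> _] _.
by move/(_ _ _ erefl).
Qed.

(** A box may hold several copies of [i], so the box does not tell which occurrence moves. An
    occurrence in [Y] is impossible: with no [i.+1] between it and the displayed [i], the latter
    would be uncancelled in [v]. *)
Lemma cat_last_split i p u v X Y v0 :
  u ++ (i, p) :: v = (X ++ Y) ++ (i, p) :: v0 ->
  eps i (word_of u) = 0 -> phi i (word_of v) = 0 ->
  (i, p) \notin X -> i.+1 \notin word_of Y -> (i, p) \notin v0 ->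
  u = X ++ Y /\ v = v0.
Proof.
move=> E eu pv nX nY nv0.
case: (cat_cons_split E) => [[v1 e1 e2]|[[|y u1] e1]].
- exfalso; case: (cat_cons_split (esym e1)) => [[v2 e3 _]|[u2 _ e3]].
    by move: nX; rewrite e3 mem_cat mem_head orbT.
  move: pv nY; rewrite e2 e3 /word_of !map_cat /= mem_cat inE !negb_or.
  move=> pv /and3P[_ _ /eps_notin ev1]; move: pv.
  by rewrite phi_cat ev1 /= (_ : i == i.+1 = false) ?eqxx; lia.
- by rewrite e1 cats0 /= => -[->].
- by move=> [_ e2]; move: nv0; rewrite e2 mem_cat mem_head orbT.
Qed.

(** Dually, for an occurrence in [Y] the displayed [i.+1] would be uncancelled in [u]. An occurrence
    inside [u0] remains possible and is excluded at each use. *)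
Lemma cat_first_split i p u v u0 Y Z :
  u ++ (i.+1, p) :: v = u0 ++ (i.+1, p) :: Y ++ Z -> eps i (word_of u) = 0 ->
  i \notin word_of Y -> (i.+1, p) \notin Z ->
  (exists2 v1, u0 = u ++ (i.+1, p) :: v1 & v = v1 ++ (i.+1, p) :: Y ++ Z) \/
  u = u0 /\ v = Y ++ Z.
Proof.
move=> E eu nY nZ.
case: (cat_cons_split E) => [[v1 e1 e2]|[[|y u1] e1]].
- by left; exists v1.
- by rewrite e1 cats0 /= => -[->]; right.
- move=> [ey e2]; exfalso; case: (cat_cons_split (esym e2)) => [[v2 e3 _]|[u2 _ e3]].
    move: eu nY; rewrite e1 e3 -ey /word_of !map_cat mem_cat negb_or eps_cat /=.
    move=> eu /andP[/phi_notin pu _]; move: eu; rewrite eqxx pu; lia.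
  by move: nZ; rewrite e3 mem_cat mem_head orbT.
Qed.

(** * Reading words of multiset-valued tableaux *)

Section Partition.
Variables (la : seq nat) (hla : is_partition la).

Lemma part_nth_le r r' : r <= r' -> nth 0 la r' <= nth 0 la r.
Proof.
case: hla => sla _ rr'.
have [lt|ge] := ltnP r' (size la); last by rewrite nth_default.
have geqT : transitive geq by move=> a b c /= ab bc; exact: leq_trans bc ab.
have := sorted_leq_nth geqT leqnn 0 sla; apply=> //=.
by rewrite inE (leq_ltn_trans rr').
Qed.

Lemma part_nth_head r : nth 0 la r <= head 0 la.
Proof. by rewrite -nth0; exact: part_nth_le. Qed.

Lemma part_size r c : c < nth 0 la r -> r < size la.
Proof. by case: (ltnP r (size la)) => // /(nth_default 0) ->. Qed.

End Partition.

Lemma mem_column la c (p : nat * nat) :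
  (p \in column la c) = (p.2 == c) && (p.2 < nth 0 la p.1).
Proof.
apply/mapP/andP => [[r]|[/eqP e lt]].
  by rewrite mem_filter => /andP[lt _] -> /=; rewrite eqxx.
exists p.1; last by rewrite -e -surjective_pairing.
rewrite mem_filter -{1}e lt mem_iota /= add0n.
by case: (ltnP p.1 (size la)) lt => // /(nth_default 0) ->.
Qed.

Definition col_above (la : seq nat) r c : seq (nat * nat) :=
  [seq (r', c) | r' <- iota 0 r & c < nth 0 la r'].
Definition col_below (la : seq nat) r c : seq (nat * nat) :=
  [seq (r', c) | r' <- iota r.+1 (size la - r.+1) & c < nth 0 la r'].

Lemma column_split la r c : c < nth 0 la r ->
  column la c = col_above la r c ++ (r, c) :: col_below la r c.
Proof.
move=> lt; have rs := part_size lt.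
rewrite /column /col_above /col_below.
have -> : iota 0 (size la) = iota 0 r ++ r :: iota r.+1 (size la - r.+1).
  rewrite -[r :: _]/(iota r (size la - r.+1).+1) -iotaD; congr iota; lia.
by rewrite filter_cat map_cat /= lt.
Qed.

Lemma mem_col_above la r c (q : nat * nat) : (q \in col_above la r c) =
  [&& q.1 < r, q.2 == c & q.2 < nth 0 la q.1].
Proof.
apply/mapP/and3P => [[r']|[lt /eqP e lt']].
  by rewrite mem_filter mem_iota /= => /andP[lt lt'] ->.
exists q.1; last by rewrite -e -surjective_pairing.
by rewrite mem_filter mem_iota -{1}e lt' lt.
Qed.

Lemma mem_col_below la r c (q : nat * nat) : (q \in col_below la r c) =
  [&& r < q.1, q.2 == c & q.2 < nth 0 la q.1].
Proof.
apply/mapP/and3P => [[r']|[lt /eqP e lt']].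
  by rewrite mem_filter mem_iota /= => /andP[lt /andP[lt' _]] ->.
exists q.1; last by rewrite -e -surjective_pairing.
rewrite mem_filter mem_iota -{1}e lt' lt /=.
by have := part_size lt'; lia.
Qed.

Lemma col_below_cons la r c : c < nth 0 la r.+1 ->
  col_below la r c = (r.+1, c) :: col_below la r.+1 c.
Proof.
move=> lt; rewrite /col_below.
have -> : size la - r.+1 = (size la - r.+2).+1 by have := part_size lt; lia.
by rewrite /= lt.
Qed.

Lemma box_set_box T (p : nat * nat) b (q : nat * nat) :
  box (set_box T p b) q = if q == p then b else box T q.
Proof.
case: p q => r c [r' c']; rewrite /box /set_box /= nth_set_nth /= xpair_eqE.
by case: eqP => [->|_] //=; rewrite nth_set_nth /=.
Qed.

Lemma nth_shape (T : mvtab) r : nth 0 (shape T) r = size (nth [::] T r).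
Proof.
have [lt|ge] := ltnP r (size T); first by rewrite (nth_map [::]).
by rewrite !nth_default ?size_map.
Qed.

Lemma box_out (T : mvtab) r c : ~~ (c < nth 0 (shape T) r) -> box T (r, c) = [::].
Proof. by rewrite nth_shape -leqNgt => ge; rewrite /box nth_default. Qed.

Lemma shape_set_box T p b : p.2 < nth 0 (shape T) p.1 ->
  shape (set_box T p b) = shape T.
Proof.
move=> lt; have rs := part_size lt; rewrite size_map in rs.
apply: (@eq_from_nth _ 0).
  by rewrite !size_map size_set_nth; apply/maxn_idPr.
move=> r _; rewrite !nth_shape nth_set_nth /=; case: eqP => [->|//].
by rewrite size_set_nth; apply/maxn_idPr; rewrite -nth_shape.
Qed.

Definition rd_heads (T : mvtab) (C : seq (nat * nat)) : seq letter :=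
  [seq (head 0 (box T p), p) | p <- rev C].
Definition rd_rest (T : mvtab) (C : seq (nat * nat)) : seq letter :=
  [seq (x, p) | p <- C, x <- behead (box T p)].
Definition rd_cols (T : mvtab) (m k : nat) : seq letter :=
  flatten [seq mv_rd_col T c | c <- iota m k].

(** The reading word around box [p]: the part before its minimum, the part between the minimum and
    its other letters ([rd_mid], only letters of boxes above), and the part after these. None of the
    three reads box [p], so they survive its replacement. *)
Definition rd_pre (T : mvtab) p : seq letter :=
  rd_cols T 0 p.2 ++ rd_heads T (col_below (shape T) p.1 p.2).
Definition rd_mid (T : mvtab) p : seq letter :=
  rd_heads T (col_above (shape T) p.1 p.2) ++
  rd_rest T (col_above (shape T) p.1 p.2).
Definition rd_post (T : mvtab) p : seq letter :=
  rd_rest T (col_below (shape T) p.1 p.2) ++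
  rd_cols T p.2.+1 (head 0 (shape T) - p.2.+1).
Definition tag_letters (p : nat * nat) (s : seq nat) : seq letter :=
  [seq (x, p) | x <- s].

Lemma rd_heads_cat T C D : rd_heads T (C ++ D) = rd_heads T D ++ rd_heads T C.
Proof. by rewrite /rd_heads rev_cat map_cat. Qed.

Lemma rd_rest_cat T C D : rd_rest T (C ++ D) = rd_rest T C ++ rd_rest T D.
Proof. by rewrite /rd_rest map_cat flatten_cat. Qed.

Lemma rd_cols_cat T m k l : rd_cols T m (k + l) = rd_cols T m k ++ rd_cols T (m + k) l.
Proof. by rewrite /rd_cols iotaD map_cat flatten_cat. Qed.

Lemma mv_rd_col_split T p : p.2 < nth 0 (shape T) p.1 ->
  mv_rd_col T p.2 = rd_heads T (col_below (shape T) p.1 p.2) ++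
    (head 0 (box T p), p) :: rd_mid T p ++ tag_letters p (behead (box T p)) ++
    rd_rest T (col_below (shape T) p.1 p.2).
Proof.
case: p => r c /= lt; rewrite /mv_rd_col -/(rd_heads T _) -/(rd_rest T _).
rewrite (column_split lt) rd_heads_cat rd_rest_cat /rd_mid /=.
rewrite -cat1s rd_heads_cat (_ : rd_rest T ([:: (r, c)] ++ _) =
  tag_letters (r, c) (behead (box T (r, c))) ++ rd_rest T (col_below (shape T) r c)) //.
by rewrite -!catA.
Qed.

Lemma mv_rd_split T p : is_partition (shape T) -> p.2 < nth 0 (shape T) p.1 ->
  mv_rd T = rd_pre T p ++ (head 0 (box T p), p) :: rd_mid T p ++
    tag_letters p (behead (box T p)) ++ rd_post T p.
Proof.
move=> hla lt; rewrite /mv_rd -/(rd_cols T 0 _).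
have := leq_trans lt (part_nth_head hla _) => lt'.
rewrite -[X in rd_cols T 0 X](subnKC lt') -addn1 -addnA rd_cols_cat add1n.
rewrite -add1n rd_cols_cat !add0n.
have -> : rd_cols T p.2 1 = mv_rd_col T p.2 by rewrite /rd_cols /= cats0.
by rewrite mv_rd_col_split // addn1 /rd_pre /rd_post -!catA /= -!catA.
Qed.

Lemma eq_rd_heads T T' C : {in C, forall q, head 0 (box T' q) = head 0 (box T q)} ->
  rd_heads T' C = rd_heads T C.
Proof. by move=> e; apply/eq_in_map => q; rewrite mem_rev => /e ->. Qed.

Lemma eq_rd_rest T T' C : {in C, forall q, box T' q = box T q} ->
  rd_rest T' C = rd_rest T C.
Proof.
by move=> e; rewrite /rd_rest; congr flatten; apply/eq_in_map => q /e ->.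
Qed.

Lemma eq_rd_cols T T' m k : shape T' = shape T ->
  (forall q, m <= q.2 < m + k -> box T' q = box T q) ->
  rd_cols T' m k = rd_cols T m k.
Proof.
move=> es e; rewrite /rd_cols; congr flatten; apply/eq_in_map => c.
rewrite mem_iota => ck; rewrite /mv_rd_col es.
have {}e : {in column (shape T) c, forall q, box T' q = box T q}.
  by move=> q; rewrite mem_column => /andP[/eqP qc _]; apply: e; rewrite qc.
rewrite -!/(rd_heads _ _) -!/(rd_rest _ _) (eq_rd_rest e); congr cat.
by apply: eq_rd_heads => q /e ->.
Qed.

Lemma mv_rd_set_box T (p : nat * nat) b : is_partition (shape T) ->
  p.2 < nth 0 (shape T) p.1 ->
  mv_rd (set_box T p b) = rd_pre T p ++ (head 0 b, p) :: rd_mid T p ++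
    tag_letters p (behead b) ++ rd_post T p.
Proof.
move=> hla lt; set T' := set_box T p b.
have es : shape T' = shape T by exact: shape_set_box.
have eb (q : nat * nat) : q != p -> box T' q = box T q.
  by rewrite box_set_box => /negPf->.
have ec (q : nat * nat) : q.2 != p.2 -> box T' q = box T q.
  by move=> qp; apply: eb; apply: contraNneq qp => ->.
have er (q : nat * nat) : q.1 != p.1 -> box T' q = box T q.
  by move=> qp; apply: eb; apply: contraNneq qp => ->.
rewrite (@mv_rd_split _ p) ?es // /rd_pre /rd_mid /rd_post es.
rewrite box_set_box eqxx !(@eq_rd_cols T T') //; first last.
- by move=> q qp; apply: ec; lia.
- by move=> q qp; apply: ec; lia.
rewrite !(@eq_rd_heads T T') ?(@eq_rd_rest T T') // => q.
all: rewrite ?mem_col_above ?mem_col_below => /and3P[? _ _]; rewrite er //; lia.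
Qed.

Lemma rd_post_below T r c : c < nth 0 (shape T) r.+1 ->
  rd_post T (r, c) =
    tag_letters (r.+1, c) (behead (box T (r.+1, c))) ++ rd_post T (r.+1, c).
Proof. by move=> lt; rewrite /rd_post /= col_below_cons // catA. Qed.

(** The remaining letters of a box and of the box below are adjacent in the word, so a letter passed
    between the two stays in place. The minimum of the lower box must be kept because it is read
    earlier, in [rd_pre]. *)
Lemma mv_rd_set_box2 T r c b d : is_partition (shape T) ->
  c < nth 0 (shape T) r.+1 -> head 0 d = head 0 (box T (r.+1, c)) ->
  mv_rd (set_box (set_box T (r, c) b) (r.+1, c) d) =
  rd_pre T (r, c) ++ (head 0 b, (r, c)) :: rd_mid T (r, c) ++
    tag_letters (r, c) (behead b) ++ tag_letters (r.+1, c) (behead d) ++ rd_post T (r.+1, c).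
Proof.
move=> hla lt hd; have lt' : c < nth 0 (shape T) r.
  exact: leq_trans lt (part_nth_le hla (leqnSn r)).
set T1 := set_box T _ b; set T2 := set_box T1 _ d.
have es1 : shape T1 = shape T by exact: shape_set_box.
have es2 : shape T2 = shape T by rewrite shape_set_box ?es1.
have eb (q : nat * nat) : box T2 q = if q == (r.+1, c) then d else
    if q == (r, c) then b else box T q.
  by rewrite !box_set_box.
have ec (q : nat * nat) : q.2 != c -> box T2 q = box T q.
  by case: q => r' c' /= /negPf qc; rewrite eb !xpair_eqE qc !andbF.
rewrite (@mv_rd_split _ (r, c)) ?es2 // rd_post_below ?es2 //.
rewrite /rd_pre /rd_mid /rd_post es2 /=.
rewrite !(@eq_rd_cols T T2) //; first last.
- by move=> q qp; apply: ec; lia.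
- by move=> q qp; apply: ec; lia.
rewrite (_ : box T2 (r, c) = b); last first.
  by rewrite eb eqxx xpair_eqE (_ : r == r.+1 = false) //; lia.
rewrite (_ : box T2 (r.+1, c) = d); last by rewrite eb eqxx.
rewrite !(@eq_rd_heads T T2) ?(@eq_rd_rest T T2) // => -[r' c'].
all: rewrite ?mem_col_above ?mem_col_below /= => /and3P[/= ? /= /eqP-> _];
  rewrite eb !xpair_eqE eqxx !andbT.
- by rewrite !ifF //; lia.
- by rewrite !ifF //; lia.
- by rewrite !ifF //; lia.
- by case: eqP => [-> //|_]; rewrite ifF //; lia.
Qed.

Lemma mem_rd_heads T C x (q : nat * nat) :
  ((x, q) \in rd_heads T C) = (q \in C) && (x == head 0 (box T q)).
Proof.
apply/mapP/andP => [[q']|[qC /eqP->]]; last by exists q; rewrite ?mem_rev.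
by rewrite mem_rev => q'C [-> ->].
Qed.

Lemma mem_rd_rest T C x (q : nat * nat) :
  ((x, q) \in rd_rest T C) = (q \in C) && (x \in behead (box T q)).
Proof.
apply/allpairsPdep/andP => [[q' [x' [q'C x'q [-> ->]]]] //|[qC xq]].
by exists q, x.
Qed.

Lemma mem_rd_col T c x (q : nat * nat) : ((x, q) \in mv_rd_col T c) =
  (q \in column (shape T) c) && (x \in head 0 (box T q) :: behead (box T q)).
Proof.
by rewrite mem_cat mem_rd_heads mem_rd_rest inE -andb_orr.
Qed.

Lemma mem_rd_cols T m k x (q : nat * nat) : ((x, q) \in rd_cols T m k) =
  [&& m <= q.2 < m + k, q.2 < nth 0 (shape T) q.1
    & x \in head 0 (box T q) :: behead (box T q)].
Proof.
apply/flattenP/and3P => [[s /mapP[c ck ->]]|[qk lt xq]].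
  rewrite mem_iota in ck; rewrite mem_rd_col mem_column.
  by case/andP=> /andP[/eqP-> ->] ->.
exists (mv_rd_col T q.2); last by rewrite mem_rd_col mem_column eqxx lt.
by apply: map_f; rewrite mem_iota.
Qed.

Lemma mem_tag_letters p s x (q : nat * nat) :
  ((x, q) \in tag_letters p s) = (q == p) && (x \in s).
Proof.
apply/mapP/andP => [[y ys [-> ->]]|[/eqP-> xs]]; first by rewrite eqxx.
by exists x.
Qed.

Lemma mem_word_of (w : seq letter) x : reflect (exists q, (x, q) \in w) (x \in word_of w).
Proof.
by apply: (iffP mapP) => [[[y q] yw /= ->]|[q qw]]; [exists q|exists (x, q)].
Qed.

Lemma word_of_cat u v : word_of (u ++ v) = word_of u ++ word_of v.
Proof. exact: map_cat. Qed.

Lemma word_of_tag_letters p s : word_of (tag_letters p s) = s.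
Proof. by rewrite /word_of /tag_letters -map_comp map_id. Qed.

(** * Sorted lists, and the order of the letters in a tableau *)

Lemma sorted_head_le s x : sorted leq s -> x \in s -> head 0 s <= x.
Proof.
case: s => //= y s /(order_path_min leq_trans)/allP ys.
by rewrite inE => /predU1P[->|/ys].
Qed.

Lemma sorted_last_ge s x : sorted leq s -> x \in s -> x <= last 0 s.
Proof.
case/lastP: s => // s y; rewrite last_rcons -[sorted _ _]rev_sorted rev_rcons.
move=> /= ps; rewrite mem_rcons inE => /predU1P[->//|xs].
have /allP := order_path_min (fun a b c ab bc => leq_trans bc ab) ps.
by apply; rewrite mem_rev.
Qed.

Lemma mem_head0 (s : seq nat) : s <> [::] -> head 0 s \in s.
Proof. by case: s => // x s _; rewrite mem_head. Qed.

Lemma mem_last0 (s : seq nat) : s <> [::] -> last 0 s \in s.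
Proof. by case: s => // x s _; exact: (mem_last x s). Qed.

Lemma sorted_split_last s i : sorted leq s -> i \in s -> exists a b,
  [/\ s = a ++ i :: b, {in a, forall x, x <= i} & {in b, forall x, i < x}].
Proof.
elim: s => //= x s IH ps; rewrite inE.
have /allP min := order_path_min leq_trans ps.
case: (boolP (i \in s)) => [iS _|niS].
  have [a [b [-> ai bi]]] := IH (path_sorted ps) iS.
  exists (x :: a), b; split=> // y; rewrite inE => /predU1P[->|/ai//].
  exact: min.
rewrite orbF => /eqP ix; exists [::], s; split=> //; first by rewrite ix.
move=> y ys; rewrite ltn_neqAle ix min // andbT -ix.
by apply: contraNneq niS => ->.
Qed.

Lemma sorted_split_first s i : sorted leq s -> i \in s -> exists a b,
  [/\ s = a ++ i :: b, {in a, forall x, x < i} & {in b, forall x, i <= x}].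
Proof.
elim: s => //= x s IH ps; rewrite inE.
have /allP min := order_path_min leq_trans ps.
have [ix _|ix /= iS] := eqVneq i x.
  by exists [::], s; split=> //; rewrite ix.
have [a [b [-> ai bi]]] := IH (path_sorted ps) iS.
exists (x :: a), b; split=> // y; rewrite inE => /predU1P[->|/ai//].
by rewrite ltn_neqAle eq_sym ix min.
Qed.

Lemma mset_addE x b s : perm_eq s (x :: b) -> sorted leq s -> mset_add x b = s.
Proof.
move=> pe ss; apply: (sorted_eq leq_trans anti_leq) => //.
  exact: (sort_sorted leq_total).
by rewrite perm_sort perm_sym.
Qed.

Lemma rem_mid (a b : seq nat) i : sorted leq (a ++ i :: b) ->
  rem i (a ++ i :: b) = a ++ b.
Proof.
move=> ss; apply: (sorted_eq leq_trans anti_leq).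
- exact: (subseq_sorted leq_trans (rem_subseq _ _)).
- apply: (subseq_sorted leq_trans _ ss).
  by apply: cat_subseq => //; exact: subseq_cons.
rewrite -(perm_cons i) perm_sym.
apply: (perm_trans (y := a ++ i :: b)).
  by rewrite -cat1s perm_catCA.
by apply: perm_to_rem; rewrite mem_cat mem_head orbT.
Qed.

Lemma sorted_mid (a b : seq nat) i : sorted leq (a ++ b) ->
  {in a, forall x, x <= i} -> {in b, forall x, i <= x} ->
  sorted leq (a ++ i :: b).
Proof.
move=> ss ai bi; move: ss; rewrite !(sorted_pairwise leq_trans) !pairwise_cat /=.
move=> /and3P[ab -> ->]; rewrite allrel_consr ab !andbT.
by apply/andP; split; apply/allP => x; [move/ai|move/bi].
Qed.

Section MVTorder.
Variables (la : seq nat) (hla : is_partition la) (T : mvtab).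
Hypothesis hT : MVT_inf la T.

Lemma MVT_shape : shape T = la. Proof. by case: hT. Qed.

Lemma box_ne r c : c < nth 0 la r -> box T (r, c) <> [::].
Proof. by case: hT => _ h _ _ /h[]. Qed.

Lemma box_sorted r c : sorted leq (box T (r, c)).
Proof.
case: hT => es h _ _; have [/h[]//|nlt] := boolP (c < nth 0 la r).
by rewrite box_out ?es.
Qed.

Lemma box_pos r c x : x \in box T (r, c) -> 0 < x.
Proof.
case: hT => es h _ _; have [/h[_ _ pos]/pos //|nlt] := boolP (c < nth 0 la r).
by rewrite box_out ?es.
Qed.

Lemma box_in_shape r c x : x \in box T (r, c) -> c < nth 0 la r.
Proof.
by case: hT => es _ _ _; apply: contraTT => nlt; rewrite box_out ?es.
Qed.

Lemma box_row r c c' x y : x \in box T (r, c) -> y \in box T (r, c') -> c < c' ->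
  x <= y.
Proof.
move=> xc yc' lt; elim: c' y yc' lt => // c' IH y yc' lt.
have lt' := box_in_shape yc'.
have cc' : last 0 (box T (r, c')) <= head 0 (box T (r, c'.+1)).
  by case: hT => _ _ /(_ _ _ lt').
have hy := sorted_head_le (box_sorted _ _) yc'.
apply: leq_trans (leq_trans cc' hy).
move: lt; rewrite ltnS leq_eqVlt => /predU1P[<-|lt].
  exact: sorted_last_ge (box_sorted _ _) xc.
by apply: IH => //; apply/mem_last0/box_ne/ltnW.
Qed.

Lemma box_col r r' c x y : x \in box T (r, c) -> y \in box T (r', c) -> r < r' ->
  x < y.
Proof.
move=> xc yc' lt; elim: r' y yc' lt => // r' IH y yc' lt.
have lt' := box_in_shape yc'.
have cc' : last 0 (box T (r', c)) < head 0 (box T (r'.+1, c)).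
  by case: hT => _ _ _ /(_ _ _ lt').
have hy := sorted_head_le (box_sorted _ _) yc'.
apply: leq_trans (leq_trans cc' hy); rewrite ltnS.
move: lt; rewrite ltnS leq_eqVlt => /predU1P[<-|lt].
  exact: sorted_last_ge (box_sorted _ _) xc.
apply/ltnW/IH => //; apply/mem_last0/box_ne.
exact: leq_trans lt' (part_nth_le hla (leqnSn _)).
Qed.

Lemma mem_boxE (q : nat * nat) x : q.2 < nth 0 la q.1 ->
  (x \in head 0 (box T q) :: behead (box T q)) = (x \in box T q).
Proof. by case: q => r c /= /box_ne; case: (box T (r, c)). Qed.

Lemma mem_mv_rd x (q : nat * nat) : ((x, q) \in mv_rd T) = (x \in box T q).
Proof.
case: q => r c; rewrite /mv_rd -/(rd_cols T 0 _) mem_rd_cols MVT_shape /= add0n.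
apply/idP/idP => [/and3P[_ lt]|xq].
  by rewrite -(@mem_boxE (r, c)).
have lt := box_in_shape xq.
by rewrite lt (leq_trans lt (part_nth_head hla r)) (@mem_boxE (r, c)).
Qed.

Lemma mem_rd_pre x (p q : nat * nat) : (x, q) \in rd_pre T p ->
  x \in box T q /\ (q.2 < p.2 \/ [/\ q.2 = p.2, p.1 < q.1 & x = head 0 (box T q)]).
Proof.
rewrite mem_cat mem_rd_cols mem_rd_heads mem_col_below MVT_shape add0n.
case/orP=> [/and3P[/= lt lt']|/andP[/and3P[lt /eqP e lt'] /eqP ->]].
  by rewrite mem_boxE //; split=> //; left.
split; last by right.
by rewrite -mem_boxE // mem_head.
Qed.

Lemma mem_rd_mid x (p q : nat * nat) : (x, q) \in rd_mid T p ->
  [/\ x \in box T q, q.2 = p.2 & q.1 < p.1].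
Proof.
rewrite mem_cat mem_rd_heads mem_rd_rest mem_col_above MVT_shape.
rewrite -andb_orr => /andP[/and3P[lt /eqP e lt'] xq]; split=> //.
by rewrite -mem_boxE // inE.
Qed.

Lemma mem_rd_post x (p q : nat * nat) : (x, q) \in rd_post T p ->
  x \in box T q /\ (p.2 < q.2 \/ q.2 = p.2 /\ p.1 < q.1).
Proof.
rewrite mem_cat mem_rd_cols mem_rd_rest mem_col_below MVT_shape.
case/orP=> [/andP[/and3P[lt /eqP e lt'] xq]|/and3P[/andP[lt _] lt']].
  by split; [rewrite -mem_boxE // inE xq orbT|right].
by rewrite mem_boxE //; split=> //; left.
Qed.

Lemma MVT_set_box r c b : c < nth 0 la r -> b <> [::] -> sorted leq b ->
  {in b, forall x, 0 < x} ->
  (0 < c -> last 0 (box T (r, c.-1)) <= head 0 b) ->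
  (c.+1 < nth 0 la r -> last 0 b <= head 0 (box T (r, c.+1))) ->
  (0 < r -> last 0 (box T (r.-1, c)) < head 0 b) ->
  (c < nth 0 la r.+1 -> last 0 b < head 0 (box T (r.+1, c))) ->
  MVT_inf la (set_box T (r, c) b).
Proof.
move=> lt b0 sb pb hl hr hu hd; case: hT => es h1 h2 h3; split.
- by rewrite shape_set_box es.
- move=> r' c' lt'; rewrite box_set_box; case: eqP => // _; exact: h1.
- move=> r' c' lt'; rewrite !box_set_box !xpair_eqE.
  case: (eqVneq r' r) => [er|nr] /=; last exact: h2.
  subst r'; have [e1|n1] := eqVneq c' c.
    subst c'; rewrite ifF; last by lia.
    exact: hr.
  case: (eqVneq c'.+1 c) => [e2|n2]; last exact: h2.
  by subst c; apply: hl.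
- move=> r' c' lt'; rewrite !box_set_box !xpair_eqE.
  case: (eqVneq c' c) => [er|nr]; rewrite ?andbT ?andbF; last exact: h3.
  subst c'; have [e1|n1] := eqVneq r' r.
    subst r'; rewrite ifF; last by lia.
    exact: hd.
  case: (eqVneq r'.+1 r) => [e2|n2]; last exact: h3.
  by subst r; apply: hu.
Qed.

End MVTorder.

Lemma eps_cat_gt0 i A Z : i \notin Z -> 0 < eps i (A ++ i.+1 :: Z).
Proof. by move=> /phi_notin pZ; rewrite eps_cat /= eqxx pZ; lia. Qed.

Lemma phi_cat_gt0 i A Z : i.+1 \notin A -> 0 < phi i (A ++ i :: Z).
Proof.
move=> /eps_notin eA; rewrite phi_cat eA /= eqxx (_ : i == i.+1 = false); lia.
Qed.

Lemma phi_gt0 i w : i \in w -> i.+1 \notin w -> 0 < phi i w.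
Proof.
move=> iw; have := phi_eps_count i w; rewrite -has_pred1 has_count in iw.
by move=> + /count_memPn h; rewrite h; lia.
Qed.

Lemma mvtab_eq (T T' : mvtab) : shape T = shape T' ->
  (forall r c, c < nth 0 (shape T) r -> box T (r, c) = box T' (r, c)) -> T = T'.
Proof.
move=> es eb; have eS : size T = size T'.
  by have := congr1 size es; rewrite !size_map.
apply: (@eq_from_nth _ [::]) => // r rT.
have er : size (nth [::] T r) = size (nth [::] T' r) by rewrite -!nth_shape es.
apply: (@eq_from_nth _ [::]) => // c cr.
by apply: (eb r c); rewrite nth_shape.
Qed.

(** * Action of the operators on reading words *)

(** [wordF] for letters with their boxes: the box may change, but neither the position in the word
    nor the column. *)
Definition rdF (i : nat) (T T' : mvtab) : Prop := exists u v p p',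
  [/\ mv_rd T = u ++ (i, p) :: v, mv_rd T' = u ++ (i.+1, p') :: v,
      p.2 = p'.2, eps i (word_of u) = 0 & phi i (word_of v) = 0].

Lemma rd_cols_right T r c : is_partition (shape T) ->
  c < nth 0 (shape T) r -> exists V',
  rd_cols T c (head 0 (shape T) - c) =
  rd_heads T (col_below (shape T) r c) ++ (head 0 (box T (r, c)), (r, c)) :: V'.
Proof.
move=> hla lt; have lt' := leq_trans lt (part_nth_head hla r).
rewrite -(subnSK lt') -add1n rd_cols_cat.
have -> : rd_cols T c 1 = mv_rd_col T c by rewrite /rd_cols /= cats0.
by rewrite (@mv_rd_col_split _ (r, c)) //= -catA cat_cons; eexists.
Qed.

Section Operators.
Variables (la : seq nat) (hla : is_partition la) (T : mvtab).
Hypothesis hT : MVT_inf la T.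

Let hS : is_partition (shape T). Proof. by rewrite (MVT_shape hT). Qed.

(** Columns increase strictly, so among the boxes below only the next one has room for [i.+1]. *)
Lemma succ_notin_below i r c r' : i \in box T (r, c) ->
  i.+1 \notin box T (r.+1, c) -> r < r' -> i.+1 \notin box T (r', c).
Proof.
move=> ip nd; rewrite leq_eqVlt => /predU1P[<- //|lt]; apply/negP => ir'.
have lt' := box_in_shape hT ir'.
have /(box_ne hT)/mem_head0 yd : c < nth 0 la r.+1.
  exact: leq_trans lt' (part_nth_le hla (ltnW lt)).
have := box_col hla hT ip yd (ltnSn r); have := box_col hla hT yd ir' lt; lia.
Qed.

Lemma notin_above i r c r' : i.+1 \in box T (r, c) ->
  (0 < r -> i \notin box T (r.-1, c)) -> r' < r -> i \notin box T (r', c).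
Proof.
case: r => // r ip /(_ isT) nd; rewrite ltnS leq_eqVlt => /predU1P[-> //|lt].
apply/negP => ir'; have lt' := box_in_shape hT ip.
have /(box_ne hT)/mem_head0 yd : c < nth 0 la r.
  exact: leq_trans lt' (part_nth_le hla (leqnSn r)).
have := box_col hla hT yd ip (ltnSn r); have := box_col hla hT ir' yd lt; lia.
Qed.

(** The row inequality for [f_i]. If the right neighbour began with [i], that [i] would be
    uncancelled after the moved one, as no [i.+1] is read in between. [M] is what separates the
    moved [i] from [rd_post]. *)
Lemma head_right_gt i r c M : i \in box T (r, c) ->
  i.+1 \notin box T (r.+1, c) -> i.+1 \notin word_of M ->
  phi i (word_of (M ++ rd_post T (r, c))) = 0 -> c.+1 < nth 0 la r ->
  i < head 0 (box T (r, c.+1)).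
Proof.
move=> ip nd nM ph lt; have yq := mem_head0 (box_ne hT lt).
rewrite ltn_neqAle (box_row hT ip yq (ltnSn c)) andbT.
apply/eqP => e; move: ph; rewrite /rd_post /=.
have [|V' ->] := rd_cols_right (r := r) (c := c.+1) hS.
  by rewrite (MVT_shape hT).
rewrite -e catA (catA (M ++ _)) word_of_cat /= => ph.
suff nY : i.+1 \notin word_of ((M ++ rd_rest T (col_below (shape T) r c)) ++
    rd_heads T (col_below (shape T) r c.+1)).
  by have := phi_cat_gt0 (word_of V') nY; rewrite ph.
have nb := succ_notin_below ip nd; rewrite !word_of_cat !mem_cat !negb_or nM /=.
rewrite (MVT_shape hT); apply/andP; split; apply/negP => /mem_word_of[[r' c']].
  rewrite mem_rd_rest mem_col_below /= => /andP[/and3P[/= rr' /= /eqP-> lt'] /mem_behead].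
  by apply/negP/nb.
(* A minimum [i.+1] lower in the right column forces the minimum of the box on its left to be [i.+1]
   as well, which [nb] excludes. *)
rewrite mem_rd_heads mem_col_below => /andP[/= /and3P[rr' /eqP-> lt'] /eqP e'].
have iq : i.+1 \in box T (r', c.+1) by rewrite e'; exact/mem_head0/(box_ne hT).
have zc := mem_head0 (box_ne hT (ltnW lt')).
have := box_row hT zc iq (ltnSn c); have := box_col hla hT ip zc rr' => h1 h2.
have ez : head 0 (box T (r', c)) = i.+1 by apply/eqP; rewrite eqn_leq h1 h2.
by move: (nb r' rr'); rewrite -ez zc.
Qed.

(** The row inequality for [e_i]. An [i.+1] in the left neighbour is read within [rd_pre] with no
    [i] after it there, so it would be uncancelled. *)
Lemma last_left_le i r c : i.+1 \in box T (r, c) ->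
  (0 < r -> i \notin box T (r.-1, c)) ->
  eps i (word_of (rd_pre T (r, c))) = 0 -> 0 < c -> last 0 (box T (r, c.-1)) <= i.
Proof.
case: c => // c ip nd ep _; rewrite [c.+1.-1]/=.
have lt := box_in_shape hT ip.
have yq := mem_last0 (box_ne hT (ltnW lt)).
have := box_row hT yq ip (ltnSn c); rewrite leq_eqVlt => /predU1P[e|//].
exfalso; move: ep; rewrite /rd_pre -addn1 rd_cols_cat add0n /=.
have -> : rd_cols T c 1 = mv_rd_col T c by rewrite /rd_cols /= cats0.
rewrite (@mv_rd_col_split _ (r, c)) /= ?(MVT_shape hT); last exact: ltnW.
rewrite ?addn1.
have nm : i \notin word_of (rd_mid T (r, c)).
  apply/negP => /mem_word_of[[r' c'] /(mem_rd_mid hT)[ir' /= ec rr']]; subst c'.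
  have lt' : c.+1 < nth 0 la r' by exact: leq_trans lt (part_nth_le hla (ltnW rr')).
  have zc := mem_head0 (box_ne hT lt').
  have := box_row hT ir' zc (ltnSn c); have := box_col hla hT zc ip rr' => h1 h2.
  have ez : head 0 (box T (r', c.+1)) = i by apply/eqP; rewrite eqn_leq -ltnS h1 h2.
  by move: (notin_above ip nd rr'); rewrite -ez zc.
have nr : i \notin word_of (rd_rest T (col_below la r c)).
  apply/negP => /mem_word_of[[r' c']]; rewrite mem_rd_rest mem_col_below.
  move=> /andP[/= /and3P[rr' /eqP-> lt'] /mem_behead ir'].
  by have := box_col hla hT yq ir' rr'; lia.
have nh : i \notin word_of (rd_heads T (col_below la r c.+1)).
  apply/negP => /mem_word_of[[r' c']]; rewrite mem_rd_heads mem_col_below.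
  move=> /andP[/= /and3P[rr' /eqP-> lt'] /eqP e'].
  by have := box_col hla hT ip (mem_head0 (box_ne hT lt')) rr'; lia.
have sq := box_sorted hT r c.
have ne := box_ne hT (ltnW lt).
rewrite !word_of_cat /= !word_of_cat word_of_tag_letters -!catA /= -!catA.
apply/eqP; rewrite -lt0n.
case Eb: (box T (r, c)) sq ne e yq => [|y s] //= sq _ e yq.
move: nm; rewrite word_of_cat mem_cat negb_or => /andP[nm1 nm2].
(* The uncancelled [i.+1] is the minimum of the left box if that equals [i.+1], and otherwise the
   last of its remaining letters. *)
have [ey|ny] := eqVneq y i.+1.
  rewrite ey catA; apply: eps_cat_gt0; rewrite !mem_cat !negb_or nm1 nm2 nr nh.
  rewrite !andbT; apply/negP => /(allP (order_path_min leq_trans sq)).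
  by rewrite ey; lia.
case/lastP: s Eb sq e yq => [|s z] Eb sq e yq.
  by move: e ny => /= ->; rewrite eqxx.
rewrite last_rcons in e; subst z.
move: (word_of (rd_cols T 0 c)) (word_of (rd_heads T (col_below la r c))) => A B.
move: (word_of (rd_heads T (col_above _ _ _))) (word_of (rd_rest T (col_above _ _ _))) => M M'.
move: nr nh; move: (word_of (rd_rest _ _)) (word_of (rd_heads _ _)) => N N' nN nN'.
rewrite (_ : A ++ _ = (A ++ B ++ y :: M ++ M' ++ s) ++ i.+1 :: N ++ N').
  by apply: eps_cat_gt0; rewrite mem_cat negb_or nN nN'.
by rewrite -cats1 -!catA /= -!catA.
Qed.

Let lt_shape r c : c < nth 0 la r -> (r, c).2 < nth 0 (shape T) (r, c).1.
Proof. by rewrite (MVT_shape hT). Qed.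

(** Neighbours see only the extreme letters of a box, so the left and upper ones matter only if [a]
    is empty, the right and lower ones only if [b] is. *)
Lemma MVT_replace r c a b x y : box T (r, c) = a ++ x :: b -> 0 < y ->
  {in a, forall z, z <= y} -> {in b, forall z, y <= z} ->
  (a = [::] -> 0 < c -> last 0 (box T (r, c.-1)) <= y) ->
  (a = [::] -> 0 < r -> last 0 (box T (r.-1, c)) < y) ->
  (b = [::] -> c.+1 < nth 0 la r -> y <= head 0 (box T (r, c.+1))) ->
  (b = [::] -> c < nth 0 la r.+1 -> y < head 0 (box T (r.+1, c))) ->
  MVT_inf la (set_box T (r, c) (a ++ y :: b)).
Proof.
move=> Eb y0 ay yb hl hu hr hd.
have sb : sorted leq (a ++ x :: b) by rewrite -Eb (box_sorted hT).
have xp : x \in box T (r, c) by rewrite Eb mem_cat mem_head orbT.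
have ap z : z \in a -> z \in box T (r, c) by rewrite Eb mem_cat => ->.
have bp z : z \in b -> z \in box T (r, c).
  by rewrite Eb mem_cat inE => ->; rewrite !orbT.
have lt := box_in_shape hT xp.
apply: (MVT_set_box hT lt).
- by case: (a).
- apply: sorted_mid => //; apply: (subseq_sorted leq_trans _ sb).
  by apply: cat_subseq => //; exact: subseq_cons.
- move=> z; rewrite mem_cat inE => /or3P[/ap|/eqP->|/bp] //; exact: (box_pos hT).
- move=> c0; case: a {Eb sb ay} ap hl hu => [|a0 a] ap hl hu /=; first exact: hl.
  have := mem_last0 (box_ne hT (r := r) (c := c.-1) _) => lm.
  by apply: (box_row hT (lm _) (ap a0 _)); rewrite ?mem_head //; lia.
- move=> lt'; rewrite last_cat /=.
  case: b {Eb sb yb} bp hr hd => [|b0 b] bp hr hd /=; first exact: hr.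
  exact: (box_row hT (bp _ (mem_last _ _)) (mem_head0 (box_ne hT lt'))).
- move=> r0; case: a {Eb sb ay} ap hl hu => [|a0 a] ap hl hu /=; first exact: hu.
  have lt' : c < nth 0 la r.-1 by apply: leq_trans lt (part_nth_le hla (leq_pred r)).
  apply: (box_col hla hT (mem_last0 (box_ne hT lt')) (ap a0 _)); rewrite ?mem_head //.
  by rewrite prednK.
- move=> lt'; rewrite last_cat /=.
  case: b {Eb sb yb} bp hr hd => [|b0 b] bp hr hd /=; first exact: hd.
  exact: (box_col hla hT (bp _ (mem_last _ _)) (mem_head0 (box_ne hT lt'))).
Qed.

(** The last copy of [i] in the box is the one that moves. If it is also the minimum, its being
    uncancelled excludes [i.+1] from the box below, so no box is emptied. *)
Lemma mv_fP i T' : mv_f i T = Some T' -> MVT_inf la T' /\ rdF i T T'.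
Proof.
rewrite /mv_f; have := rightmost_plusP i (mv_rd T).
case: rightmost_plus => [[r c]|] // [u [v [E eu pv]]].
have ip : i \in box T (r, c) by rewrite -(mem_mv_rd hla hT) E mem_cat mem_head orbT.
have lt := box_in_shape hT ip.
have [a [b [Eb ai bi]]] := sorted_split_last (box_sorted hT r c) ip.
have sb : sorted leq (a ++ i :: b) by rewrite -Eb (box_sorted hT).
have nb : i \notin b by apply/negP => /bi; rewrite ltnn.
have Erd := mv_rd_split hS (lt_shape lt); rewrite Eb in Erd.
have nmid x : x \in word_of (rd_mid T (r, c)) -> x < i.
  move=> /mem_word_of[[r' c'] /(mem_rd_mid hT)[xq /= ec rr']]; subst c'.
  exact: (box_col hla hT xq ip).
have npre : (i, (r, c)) \notin rd_pre T (r, c).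
  by apply/negP => /(mem_rd_pre hT)[_ [|[_]]] /=; rewrite ltnn.
have npost : (i, (r, c)) \notin rd_post T (r, c).
  by apply/negP => /(mem_rd_post hT)[_ [|[_]]] /=; rewrite ltnn.
have pre_pos := box_pos hT ip.
have repl : mset_add i.+1 (rem i (box T (r, c))) = a ++ i.+1 :: b.
  rewrite Eb rem_mid //; apply: mset_addE; first by rewrite -cat1s perm_catCA.
  apply: sorted_mid; last exact: bi.
    apply: (subseq_sorted leq_trans _ sb).
    by apply: cat_subseq => //; exact: subseq_cons.
  by move=> x /ai /leqW.
have HM : i.+1 \notin box T (r.+1, c) ->
    (b = [::] -> c.+1 < nth 0 la r -> i < head 0 (box T (r, c.+1))) ->
    MVT_inf la (set_box T (r, c) (a ++ i.+1 :: b)).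
  move=> nd hr; apply: (MVT_replace Eb) => //.
  - by move=> x /ai /leqW.
  - move=> _ c0; apply: leqW; apply: (box_row hT (mem_last0 (box_ne hT _)) ip); lia.
  - case: r {E Eb Erd nmid npre npost repl nd hr} ip lt => // r ip lt _ _.
    have lt' : c < nth 0 la r by apply: leq_trans lt (part_nth_le hla (leqnSn r)).
    exact/leqW/(box_col hla hT (mem_last0 (box_ne hT lt')) ip).
  - move=> _ lt'; have hd := mem_head0 (box_ne hT lt').
    rewrite ltn_neqAle (box_col hla hT ip hd (ltnSn r)) andbT.
    by apply: contraNneq nd => ->.
(* With [a] empty, [i] occurs once, as the minimum, and is read directly after the minimum of the
   box below, if there is one. *)
case: a ai Eb sb Erd repl HM => [|a0 a] ai Eb sb Erd repl HM.
  have [eu' ev'] : u = rd_pre T (r, c) ++ [::] /\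
      v = rd_mid T (r, c) ++ tag_letters (r, c) b ++ rd_post T (r, c).
    apply: (@cat_last_split i (r, c)) => //; first by rewrite -E Erd cats0.
    rewrite mem_cat [X in _ || X]mem_cat mem_tag_letters eqxx (negPf nb) (negPf npost) !orbF.
    apply/negP => iq; suff /nmid : i \in word_of (rd_mid T (r, c)) by rewrite ltnn.
    by apply/mem_word_of; exists (r, c).
  rewrite cats0 in eu'.
  have nd : i.+1 \notin box T (r.+1, c).
    apply/negP => id; have ltd := box_in_shape hT id.
    have hd := mem_head0 (box_ne hT ltd).
    have h1 := box_col hla hT ip hd (ltnSn r).
    have h2 := sorted_head_le (box_sorted hT _ _) id.
    have ed : head 0 (box T (r.+1, c)) = i.+1 by apply/eqP; rewrite eqn_leq h1 h2.
    move: eu; rewrite eu' /rd_pre (MVT_shape hT) col_below_cons //= -cat1s.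
    rewrite rd_heads_cat catA word_of_cat /= ed.
    have /= := @eps_cat_gt0 i
      (word_of (rd_cols T 0 c ++ rd_heads T (col_below la r.+1 c))) [::] isT.
    by move=> + e0; rewrite e0.
  rewrite (negPf nd) repl => -[<-]; split.
    apply: HM => // b0 lt'; subst b.
    apply: (@head_right_gt i r c (rd_mid T (r, c))) => //.
      by apply/negP => /nmid; lia.
    by move: pv; rewrite ev'.
  exists u, v, (r, c), (r, c); split=> //.
  by rewrite mv_rd_set_box ?(lt_shape lt) // eu' ev'.
have [eu' ev'] : u = rd_pre T (r, c) ++
    ((a0, (r, c)) :: rd_mid T (r, c) ++ tag_letters (r, c) a) /\
    v = tag_letters (r, c) b ++ rd_post T (r, c).
  apply: (@cat_last_split i (r, c)) => //.
  - by rewrite -E Erd /= /tag_letters map_cat -!catA /= -!catA.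
  - rewrite /= word_of_cat word_of_tag_letters inE mem_cat !negb_or; apply/and3P; split.
    + by apply/eqP => e; have := ai a0 (mem_head _ _); lia.
    + by apply/negP => /nmid; lia.
    + by apply/negP => h; have := ai i.+1; rewrite inE h orbT => /(_ isT); lia.
  - by rewrite mem_cat mem_tag_letters eqxx (negPf nb) (negPf npost).
have [id|nd] := boolP (i.+1 \in box T (r.+1, c)); last first.
  rewrite repl => -[<-]; split.
    apply: HM => // b0 lt'; subst b.
    by apply: (@head_right_gt i r c [::]) => //; move: pv; rewrite ev'.
  exists u, v, (r, c), (r, c); split=> //.
  rewrite mv_rd_set_box ?(lt_shape lt) // eu' ev' /=.
  by rewrite /tag_letters map_cat -!catA /= -!catA.
(* Here [i] is the maximum of its box and [i.+1] the minimum below; the added copy becomes the first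
   of the remaining letters of the lower box. *)
have ltd := box_in_shape hT id.
have b0 : b = [::].
  case: b bi Eb {sb nb Erd repl HM ev'} => // b0 b bi Eb.
  have b0p : b0 \in box T (r, c) by rewrite Eb mem_cat !inE eqxx !orbT.
  by have := box_col hla hT b0p id (ltnSn r); have := bi b0 (mem_head _ _); lia.
subst b; have hd := mem_head0 (box_ne hT ltd).
have h1 := box_col hla hT ip hd (ltnSn r).
have h2 := sorted_head_le (box_sorted hT _ _) id.
have ed : head 0 (box T (r.+1, c)) = i.+1 by apply/eqP; rewrite eqn_leq h1 h2.
rewrite Eb rem_mid // cats0.
have -> : mset_add i.+1 (box T (r.+1, c)) = i.+1 :: box T (r.+1, c).
  apply: mset_addE => //.
  move: ed (box_sorted hT r.+1 c); case: (box T _) => //= x s ->.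
  by rewrite leqnn.
move=> [<-]; split.
  have hT1 : MVT_inf la (set_box T (r, c) (a0 :: a)).
    have ap x : x \in a0 :: a -> x \in box T (r, c) by rewrite Eb mem_cat => ->.
    have lp := ap _ (mem_last a0 a); have hp := ap a0 (mem_head _ _).
    apply: (MVT_set_box hT lt) => //.
    - by apply: (subseq_sorted leq_trans _ sb); exact: prefix_subseq.
    - by move=> x /ap/(box_pos hT).
    - move=> c0; apply: (box_row hT (mem_last0 (box_ne hT _)) hp); lia.
    - by move=> lt'; apply: (box_row hT lp (mem_head0 (box_ne hT lt'))).
    - move=> r0; have lt' : c < nth 0 la r.-1.
        by apply: leq_trans lt (part_nth_le hla (leq_pred r)).
      by apply: (box_col hla hT (mem_last0 (box_ne hT lt')) hp); rewrite prednK.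
    - by move=> lt'; apply: (box_col hla hT lp hd).
  have neq c' : ((r.+1, c') == (r, c)) = false by rewrite xpair_eqE; lia.
  have neq' c' : ((r.+2, c') == (r, c)) = false by rewrite xpair_eqE; lia.
  apply: (MVT_set_box hT1 ltd) => //.
  - move: ed (box_sorted hT r.+1 c); case: (box T _) => //= x s ->.
    by rewrite leqnn.
  - by move=> x; rewrite inE => /predU1P[->|/(box_pos hT)].
  - move=> c0; rewrite box_set_box neq /=.
    apply: (box_row hT (mem_last0 (box_ne hT _)) id); lia.
  - move=> lt'; rewrite box_set_box neq /=.
    have -> : last i.+1 (box T (r.+1, c)) = last 0 (box T (r.+1, c)).
      by case: (box T _) (box_ne hT ltd).
    exact: (box_row hT (mem_last0 (box_ne hT ltd)) (mem_head0 (box_ne hT lt'))).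
  - by move=> _; rewrite box_set_box eqxx /= ltnS ai // mem_last.
  - move=> lt'; rewrite box_set_box neq' /=.
    have -> : last i.+1 (box T (r.+1, c)) = last 0 (box T (r.+1, c)).
      by case: (box T _) (box_ne hT ltd).
    exact: (box_col hla hT (mem_last0 (box_ne hT ltd)) (mem_head0 (box_ne hT lt'))).
exists u, v, (r, c), (r.+1, c); split=> //.
rewrite mv_rd_set_box2 ?(MVT_shape hT) // eu' ev' (@rd_post_below T r c) ?(MVT_shape hT) //=.
move: ed; case: (box T (r.+1, c)) (box_ne hT ltd) => //= x s _ ->.
by rewrite -!catA /= -!catA.
Qed.

(** Mirror image of [mv_fP]; [0 < i] makes the new letter a positive one. *)
Lemma mv_eP i T' : 0 < i -> mv_e i T = Some T' -> MVT_inf la T' /\ rdF i T' T.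
Proof.
move=> i0; rewrite /mv_e; have := leftmost_minusP i (mv_rd T).
case: leftmost_minus => [[r c]|] // [u [v [E eu pv]]].
have ip : i.+1 \in box T (r, c).
  by rewrite -(mem_mv_rd hla hT) E mem_cat mem_head orbT.
have lt := box_in_shape hT ip.
have [a [b [Eb ai bi]]] := sorted_split_first (box_sorted hT r c) ip.
have sb : sorted leq (a ++ i.+1 :: b) by rewrite -Eb (box_sorted hT).
have Erd := mv_rd_split hS (lt_shape lt); rewrite Eb in Erd.
have nmid x : x \in word_of (rd_mid T (r, c)) -> x < i.+1.
  move=> /mem_word_of[[r' c'] /(mem_rd_mid hT)[xq /= ec rr']]; subst c'.
  exact: (box_col hla hT xq ip).
have npre : (i.+1, (r, c)) \notin rd_pre T (r, c).
  by apply/negP => /(mem_rd_pre hT)[_ [|[_]]] /=; rewrite ltnn.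
have npost : (i.+1, (r, c)) \notin rd_post T (r, c).
  by apply/negP => /(mem_rd_post hT)[_ [|[_]]] /=; rewrite ltnn.
have nmid' : (i.+1, (r, c)) \notin rd_mid T (r, c).
  by apply/negP => /(mem_rd_mid hT)[_ _] /=; rewrite ltnn.
have [/andP[r0 iq]|nd] := boolP ((0 < r) && (i \in box T (r.-1, c))); last first.
  have {}nd : 0 < r -> i \notin box T (r.-1, c) by move=> r0; move: nd; rewrite r0.
  have -> : mset_add i (rem i.+1 (box T (r, c))) = a ++ i :: b.
    rewrite Eb rem_mid //; apply: mset_addE; first by rewrite -cat1s perm_catCA.
    apply: sorted_mid; first 1 last.
    - by move=> x /ai.
    - by move=> x /bi /ltnW.
    apply: (subseq_sorted leq_trans _ sb).
    by apply: cat_subseq => //; exact: subseq_cons.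
  have nim : i \notin word_of (rd_mid T (r, c)).
    apply/negP => /mem_word_of[[r' c'] /(mem_rd_mid hT)[xq /= ec rr']]; subst c'.
    by move: (notin_above ip nd rr'); rewrite xq.
  have nib : i \notin b by apply/negP => /bi; rewrite ltnn.
  have upre : a = [::] -> u = rd_pre T (r, c) /\
      v = (rd_mid T (r, c) ++ tag_letters (r, c) b) ++ rd_post T (r, c).
    move=> a0; rewrite a0 /= in Erd.
    have E2 : u ++ (i.+1, (r, c)) :: v = rd_pre T (r, c) ++ (i.+1, (r, c)) ::
        (rd_mid T (r, c) ++ tag_letters (r, c) b) ++ rd_post T (r, c).
      by rewrite -E Erd; congr (_ ++ _ :: _); rewrite catA.
    have nY : i \notin word_of (rd_mid T (r, c) ++ tag_letters (r, c) b).
      by rewrite word_of_cat mem_cat word_of_tag_letters negb_or nim nib.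
    case: (cat_first_split E2 eu nY npost) => [[v1 e1 _]|//].
    by move: npre; rewrite e1 mem_cat mem_head orbT.
  move=> [<-]; split.
    apply: (MVT_replace Eb) => //.
    - by move=> x /bi /ltnW.
    - move=> a0 c0; apply: last_left_le => //.
      by have [<- _] := upre a0.
    - move=> _ r0; have lt' : c < nth 0 la r.-1.
        by apply: leq_trans lt (part_nth_le hla (leq_pred r)).
      have hl := mem_last0 (box_ne hT lt').
      have := box_col hla hT hl ip; rewrite prednK // ltnS => /(_ (leqnn _)).
      by rewrite leq_eqVlt => /predU1P[e|//]; move: (nd r0); rewrite -e hl.
    - move=> _ lt'; apply: ltnW.
      exact: (box_row hT ip (mem_head0 (box_ne hT lt'))).
    - move=> _ lt'; apply: ltnW.
      exact: (box_col hla hT ip (mem_head0 (box_ne hT lt'))).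
  exists u, v, (r, c), (r, c); split=> //.
  rewrite mv_rd_set_box ?(lt_shape lt) //.
  case: a ai Eb sb Erd upre => [|a0 a] ai Eb sb Erd upre /=.
    by have [<- ->] := upre erefl; rewrite -catA.
  have E2 : u ++ (i.+1, (r, c)) :: v =
      (rd_pre T (r, c) ++ (a0, (r, c)) :: rd_mid T (r, c) ++ tag_letters (r, c) a) ++
      (i.+1, (r, c)) :: tag_letters (r, c) b ++ rd_post T (r, c).
    by rewrite -E Erd /= /tag_letters map_cat -!catA /= -!catA.
  have nib' : i \notin word_of (tag_letters (r, c) b) by rewrite word_of_tag_letters.
  case: (cat_first_split E2 eu nib' npost) => [[v1 e1 _]|[-> ->]]; last first.
    by rewrite /tag_letters map_cat -!catA /= -!catA.
  have : (i.+1, (r, c)) \in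
      rd_pre T (r, c) ++ (a0, (r, c)) :: rd_mid T (r, c) ++ tag_letters (r, c) a.
    by rewrite e1 mem_cat mem_head orbT.
  rewrite mem_cat (negPf npre) inE mem_cat (negPf nmid') mem_tag_letters eqxx /=.
  have ni : i.+1 \notin a0 :: a by apply/negP => /ai; rewrite ltnn.
  move: ni; rewrite inE negb_or => /andP[ni1 /negPf->]; rewrite orbF.
  by case/eqP=> e; rewrite e eqxx in ni1.
case: r r0 iq ip lt Eb Erd nmid npre npost nmid' E => // r _ iq ip lt Eb Erd.
move=> nmid npre npost nmid' E; rewrite [r.+1.-1]/= in iq *.
have ltq := box_in_shape hT iq.
have hq := mem_last0 (box_ne hT ltq).
have eq : last 0 (box T (r, c)) = i.
  have h1 := sorted_last_ge (box_sorted hT _ _) iq.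
  have h2 := box_col hla hT hq ip (ltnSn r).
  by apply/eqP; rewrite eqn_leq h1 -ltnS h2.
have ea : a = [::].
  case: a ai Eb {sb Erd} => // a0 a ai Eb.
  have a0p : a0 \in box T (r.+1, c) by rewrite Eb mem_head.
  by have := box_col hla hT iq a0p (ltnSn r); have := ai a0 (mem_head _ _); lia.
subst a; rewrite /= in Eb sb Erd.
have imid : i \in word_of (rd_mid T (r.+1, c)).
  apply/mem_word_of; exists (r, c); rewrite mem_cat mem_rd_heads mem_rd_rest -andb_orr.
  rewrite -in_cons (mem_boxE hT) // iq mem_col_above (MVT_shape hT) /= eqxx ltq.
  by rewrite ltnSn.
have nmidS : i.+1 \notin word_of (rd_mid T (r.+1, c)).
  by apply/negP => /nmid; rewrite ltnn.
(* The i in the box above cancels the i+1 at the head of the box, so the letter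
   that moves is the second i+1. *)
have [b' eb ev] : exists2 b', b = i.+1 :: b' &
    v = tag_letters (r.+1, c) b' ++ rd_post T (r.+1, c).
  move: (E); rewrite Erd => /esym E1.
  case: (cat_cons_split E1) => [[v1 e1 _]|[[|y u1] e1]].
  - by exfalso; move: npre; rewrite e1 mem_cat mem_head orbT.
  - move=> [e2]; exfalso; move: pv; rewrite -e2 word_of_cat phi_cat.
    by have := phi_gt0 imid nmidS; lia.
  move=> [ey E2]; case: (cat_cons_split (esym E2)) => [[v1 e2 _]|[u2 e2 E3]].
    by exfalso; move: nmid'; rewrite e2 mem_cat mem_head orbT.
  case: (cat_cons_split (esym E3)) => [[v1 e3 e4]|[u3 _ e3]]; last first.
    by exfalso; move: npost; rewrite e3 mem_cat mem_head orbT.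
  case: u2 e2 e3 {E3} => [|z u3] e2.
    case: b bi Eb sb Erd E1 E2 => [|b1 b] //= _ _ _ _ _ _ [-> e3].
    by exists b => //; rewrite e4 e3.
  (* No copy after the second can move: no [i] follows the second one inside the box, so it would be
     uncancelled in [u]. *)
  case: b bi Eb sb Erd E1 E2 => [|b1 b] //= bi Eb sb _ _ _ [ez e3].
  exfalso; have ib : i.+1 \in b.
    have : (i.+1, (r.+1, c)) \in tag_letters (r.+1, c) b.
      by rewrite e3 mem_cat mem_head orbT.
    by rewrite mem_tag_letters eqxx.
  have eb1 : b1 = i.+1.
    apply/eqP; rewrite eqn_leq (bi b1 (mem_head _ _)) andbT.
    case/andP: sb => _ /(order_path_min leq_trans)/allP; exact.
  move: eu; rewrite e1 e2 -ez eb1 word_of_cat /= word_of_cat /=.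
  set X := word_of (rd_pre T _) ++ _ => X0.
  suff : 0 < eps i X by rewrite X0.
  rewrite /X -cat_cons catA; apply: eps_cat_gt0.
  have : i \notin word_of (tag_letters (r.+1, c) b).
    rewrite word_of_tag_letters; apply/negP => h; have := bi i; rewrite inE h orbT.
    by move/(_ isT); rewrite ltnn.
  by rewrite e3 word_of_cat mem_cat negb_or => /andP[].
subst b; rewrite Eb [rem _ _]/= eqxx.
have sq := box_sorted hT r c.
have aq : {in box T (r, c), forall x, x <= i}.
  by move=> x xq; rewrite -eq; exact: sorted_last_ge.
have -> : mset_add i (box T (r, c)) = rcons (box T (r, c)) i.
  apply: mset_addE; first by rewrite perm_rcons.
  by rewrite -cats1; apply: sorted_mid => //; rewrite cats0.
have neq x y z : (x, y) == (x.+1, z) = false by rewrite xpair_eqE; lia.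
have neq' x y z : (x.+1, y) == (x, z) = false by rewrite xpair_eqE; lia.
have hd : head 0 (rcons (box T (r, c)) i) = head 0 (box T (r, c)).
  by case: (box T _) (box_ne hT ltq).
have sb' : sorted leq (i.+1 :: b') by move: sb => /= /andP[].
move=> [<-]; split.
  have hT1 : MVT_inf la (set_box T (r.+1, c) (i.+1 :: b')).
    have bp : last 0 (i.+1 :: b') \in box T (r.+1, c).
      by rewrite Eb /= inE mem_last orbT.
    apply: (MVT_set_box hT lt) => //.
    - by move=> x xb; apply: (box_pos hT (r := r.+1) (c := c)); rewrite Eb inE xb orbT.
    - move=> c0; apply: (box_row hT (mem_last0 (box_ne hT _)) ip); lia.
    - by move=> lt'; apply: (box_row hT bp (mem_head0 (box_ne hT lt'))).
    - by move=> _ /=; rewrite eq.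
    - by move=> lt'; apply: (box_col hla hT bp (mem_head0 (box_ne hT lt'))).
  apply: (MVT_set_box hT1 ltq).
  - by case: (box T _).
  - by rewrite -cats1; apply: sorted_mid => //; rewrite cats0.
  - by move=> x; rewrite mem_rcons inE => /predU1P[->|/(box_pos hT)].
  - move=> c0; rewrite box_set_box neq hd.
    apply: (box_row hT (mem_last0 (box_ne hT _)) (mem_head0 (box_ne hT ltq))); lia.
  - move=> lt'; rewrite box_set_box neq last_rcons.
    exact: (box_row hT iq (mem_head0 (box_ne hT lt'))).
  - move=> r0; rewrite box_set_box xpair_eqE ifF ?hd; last by lia.
    have lt' : c < nth 0 la r.-1.
      by apply: leq_trans ltq (part_nth_le hla (leq_pred r)).
    apply: (box_col hla hT (mem_last0 (box_ne hT lt')) (mem_head0 (box_ne hT ltq))).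
    by rewrite prednK.
  - by move=> _; rewrite box_set_box eqxx last_rcons.
have lts := lt_shape lt; have ltqs := lt_shape ltq.
(* The operator changes the lower box first, while [mv_rd_set_box2] changes the upper one first. *)
have -> : set_box (set_box T (r.+1, c) (i.+1 :: b')) (r, c) (rcons (box T (r, c)) i) =
    set_box (set_box T (r, c) (rcons (box T (r, c)) i)) (r.+1, c) (i.+1 :: b').
  apply: mvtab_eq; first by rewrite !shape_set_box // shape_set_box.
  move=> r' c' _; rewrite !box_set_box; case: eqP => [->|//]; by rewrite neq.
pose u0 := rd_pre T (r, c) ++ (head 0 (box T (r, c)), (r, c)) :: rd_mid T (r, c) ++
   tag_letters (r, c) (behead (box T (r, c))).
have E0 : mv_rd T = u0 ++ (i.+1, (r.+1, c)) :: v.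
  rewrite (mv_rd_split hS ltqs) rd_post_below // Eb ev /u0 /=.
  by rewrite -!catA /= -!catA.
(* Both splittings end in the same letter and the same [v]. *)
have eu0 : u = u0.
  move/eqP: E; rewrite E0 -!cat_rcons eq_sym => /eqP e.
  have := congr1 rev e; rewrite !rev_cat !rev_rcons.
  by move/eqP; rewrite eqseq_cat // => /andP[_ /eqP[/(can_inj revK)]].
exists u, v, (r, c), (r.+1, c); split=> //.
rewrite mv_rd_set_box2 // ?Eb // hd eu0 ev /u0.
have -> : behead (rcons (box T (r, c)) i) = rcons (behead (box T (r, c))) i.
  by case: (box T _) (box_ne hT ltq).
by rewrite /tag_letters map_rcons -cats1 -!catA /= -!catA.
Qed.

End Operators.

(** * Recovering a tableau from its reading word *)

Lemma flatten_map_nil (A B : eqType) (f : A -> seq B) (s : seq A) :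
  {in s, forall x, f x = [::]} -> flatten (map f s) = [::].
Proof.
elim: s => //= x s IH h; rewrite h ?mem_head // IH // => y ys.
by apply: h; rewrite inE ys orbT.
Qed.

Lemma filter_mv_rd T c : c < head 0 (shape T) ->
  [seq x <- mv_rd T | x.2.2 == c] = mv_rd_col T c.
Proof.
move=> lt; rewrite /mv_rd filter_flatten -map_comp.
have -> : iota 0 (head 0 (shape T)) =
    iota 0 c ++ c :: iota c.+1 (head 0 (shape T) - c.+1).
  by rewrite -[c :: _]/(iota c (_ - _).+1) -iotaD; congr iota; lia.
have h c' : {in mv_rd_col T c', forall x, x.2.2 = c'}.
  by move=> [x q]; rewrite mem_rd_col mem_column => /andP[/andP[/eqP]].
have h0 c' : c' != c -> [seq x <- mv_rd_col T c' | x.2.2 == c] = [::].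
  move=> cc'; apply/eqP; rewrite -size_eq0 size_filter -leqn0 leqNgt -has_count.
  by apply/hasPn => x /h ->.
rewrite map_cat flatten_cat (flatten_map_nil (s := iota 0 c)); last first.
  by move=> c'; rewrite mem_iota /= => h1; apply: h0; lia.
rewrite /= flatten_map_nil ?cats0; last first.
  by move=> c'; rewrite mem_iota /= => h1; apply: h0; lia.
by apply/all_filterP/allP => x /h ->; rewrite eqxx.
Qed.

Lemma word_of_rd_rest T C : word_of (rd_rest T C) = flatten [seq behead (box T q) | q <- C].
Proof.
by elim: C => //= q C IH; rewrite word_of_cat -/(tag_letters q _) word_of_tag_letters -IH.
Qed.

Section Injectivity.
Variables (la : seq nat) (hla : is_partition la).

(** The minima cut the remaining letters of a column into boxes: by strictness those of one box
    range from its own minimum to below the minimum underneath. The bottom box has no upper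
    bound. *)
Lemma behead_boxE T r c : MVT_inf la T -> c < nth 0 la r ->
  behead (box T (r, c)) =
  [seq x <- word_of (rd_rest T (column la c)) |
     (head 0 (box T (r, c)) <= x) &&
     ((c < nth 0 la r.+1) ==> (x < head 0 (box T (r.+1, c))))].
Proof.
move=> hT lt; set a := fun x => _ && _.
have hp := mem_head0 (box_ne hT lt).
rewrite word_of_rd_rest filter_flatten -map_comp (column_split lt) map_cat flatten_cat.
rewrite flatten_map_nil; last first.
  move=> [r' c']; rewrite mem_col_above /= => /and3P[/= rr' /eqP /= -> lt'].
  apply/eqP; rewrite -size_eq0 size_filter -leqn0 leqNgt -has_count.
  apply/hasPn => x /mem_behead xq; rewrite /a negb_and -ltnNge.
  by rewrite (box_col hla hT xq hp).
rewrite /= flatten_map_nil ?cats0; last first.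
  move=> [r' c']; rewrite mem_col_below /= => /and3P[/= rr' /eqP /= -> lt'].
  apply/eqP; rewrite -size_eq0 size_filter -leqn0 leqNgt -has_count.
  apply/hasPn => x /mem_behead xq; rewrite /a.
  have ltd : c < nth 0 la r.+1 by exact: leq_trans lt' (part_nth_le hla rr').
  rewrite ltd /= negb_and -leqNgt; apply/orP; right.
  move: rr'; rewrite leq_eqVlt => /predU1P[er|rr'].
    by subst r'; exact: sorted_head_le (box_sorted hT _ _) xq.
  exact/ltnW/(box_col hla hT (mem_head0 (box_ne hT ltd)) xq).
apply/esym/all_filterP/allP => x /mem_behead xp; rewrite /a.
rewrite (sorted_head_le (box_sorted hT _ _) xp) /=; apply/implyP => ltd.
exact: (box_col hla hT xp (mem_head0 (box_ne hT ltd))).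
Qed.

(* The reading word alone does not determine the tableau: both fillings
   {1,1} {1} and {1} {1,1} of a row read 111. *)
Lemma mv_rd_inj T T' : MVT_inf la T -> MVT_inf la T' ->
  word_of (mv_rd T) = word_of (mv_rd T') ->
  [seq x.2.2 | x <- mv_rd T] = [seq x.2.2 | x <- mv_rd T'] -> T = T'.
Proof.
move=> hT hT' ew ec; have es := MVT_shape hT; have es' := MVT_shape hT'.
have ecol c : c < head 0 la -> word_of (mv_rd_col T c) = word_of (mv_rd_col T' c).
  move=> lt; rewrite -!filter_mv_rd ?es ?es' // /word_of.
  elim: (mv_rd T) (mv_rd T') ew ec => [|x s IH] [|y t] //= [exy ew] [exy' ec].
  by rewrite exy'; case: ifP => _ /=; rewrite ?exy (IH t).
(* A column word begins with one minimum per box, and the shape gives the number of boxes. *)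
have esplit c : c < head 0 la ->
    [seq head 0 (box T q) | q <- rev (column la c)] =
    [seq head 0 (box T' q) | q <- rev (column la c)] /\
    word_of (rd_rest T (column la c)) = word_of (rd_rest T' (column la c)).
  move=> /ecol; rewrite /mv_rd_col es es' -!/(rd_heads _ _) -!/(rd_rest _ _).
  rewrite !word_of_cat => /eqP; rewrite eqseq_cat; last by rewrite !size_map.
  by rewrite /word_of /rd_heads -!map_comp => /andP[/eqP-> /eqP->].
have eh r c : c < nth 0 la r -> head 0 (box T (r, c)) = head 0 (box T' (r, c)).
  move=> lt; have [/eq_in_map e _] := esplit c (leq_trans lt (part_nth_head hla r)).
  by apply: e; rewrite mem_rev mem_column /= eqxx.
apply: mvtab_eq; rewrite ?es ?es' // => r c lt.
have eb : behead (box T (r, c)) = behead (box T' (r, c)).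
  have [_ er] := esplit c (leq_trans lt (part_nth_head hla r)).
  rewrite !behead_boxE // er eh //; apply: eq_filter => x.
  by case: (boolP (c < nth 0 la r.+1)) => //= ltd; rewrite eh.
move: eb (eh r c lt); case: (box T _) (box_ne hT lt) => // x s _.
by case: (box T' _) (box_ne hT' lt) => //= y t _ -> ->.
Qed.

Lemma count_rd_col T c a : MVT_inf la T ->
  count a (word_of (mv_rd_col T c)) = \sum_(q <- column la c) count a (box T q).
Proof.
move=> hT; rewrite /mv_rd_col (MVT_shape hT) -/(rd_heads _ _) -/(rd_rest _ _).
have : {in column la c, forall q, box T q <> [::]}.
  by move=> [r c']; rewrite mem_column => /andP[_ /(box_ne hT)].
elim: (column la c) => [|q C IH] h; first by rewrite big_nil.
rewrite -cat1s rd_heads_cat rd_rest_cat big_cons -IH; last first.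
  by move=> x xC; apply: h; rewrite inE xC orbT.
have -> : rd_rest T [:: q] = tag_letters q (behead (box T q)) by rewrite /rd_rest /= cats0.
have := h q (mem_head _ _); rewrite !word_of_cat word_of_tag_letters !count_cat /=.
by case: (box T q) => //= x s _; lia.
Qed.

(** Reading goes by columns, [mv_letters] by rows: an exchange of summations. *)
Lemma perm_mv_rd T : MVT_inf la T -> perm_eq (word_of (mv_rd T)) (mv_letters T).
Proof.
move=> hT; apply/permP => a; have es := MVT_shape hT.
have -> : count a (mv_letters T) =
    \sum_(0 <= r < size la) \sum_(0 <= c < nth 0 la r) count a (box T (r, c)).
  rewrite /mv_letters count_flatten sumnE big_map big_flatten /=.
  rewrite (big_nth [::]) -es size_map; apply: eq_bigr => r _.
  by rewrite (big_nth [::]) nth_shape.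
have -> : count a (word_of (mv_rd T)) = \sum_(0 <= c < head 0 la)
    \sum_(0 <= r < size la) (if c < nth 0 la r then count a (box T (r, c)) else 0).
  rewrite /mv_rd /word_of map_flatten count_flatten sumnE -!map_comp big_map es.
  rewrite /index_iota !subn0; apply: eq_bigr => c _ /=.
  by rewrite -/(word_of _) count_rd_col // big_map big_filter big_mkcond.
rewrite exchange_big /=; apply: eq_bigr => r _.
rewrite [RHS](big_nat_widen _ _ (head 0 la)); last exact: part_nth_head.
by rewrite [RHS]big_mkcond.
Qed.

Lemma box_ge T r c x : MVT_inf la T -> x \in box T (r, c) -> r < x.
Proof.
move=> hT; elim: r x => [|r IH] x xp; first exact (box_pos hT xp).
have lt : c < nth 0 la r.
  exact: leq_trans (box_in_shape hT xp) (part_nth_le hla (leqnSn r)).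
have hq := mem_head0 (box_ne hT lt).
exact: leq_ltn_trans (IH _ hq) (box_col hla hT hq xp (ltnSn r)).
Qed.

(* In a Yamanouchi word every letter [x > 1] is followed by a letter [x.-1]; for
   a minimal [x] exceeding its row index, the order conditions leave no place for
   that letter. *)
Lemma hw_box T r c x : MVT_inf la T -> yamanouchi (word_of (mv_rd T)) ->
  x \in box T (r, c) -> x = r.+1.
Proof.
move=> hT yT xp; apply/eqP; rewrite eqn_leq (box_ge hT xp) andbT.
have [n le_xn] := ubnP x; elim: n x r c le_xn xp => // n IH x r c xn xp.
rewrite leqNgt; apply/negP => rx.
have lt := box_in_shape hT xp.
have hS : is_partition (shape T) by rewrite (MVT_shape hT).
have lts : (r, c).2 < nth 0 (shape T) (r, c).1 by rewrite (MVT_shape hT).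
have x1 : x.-1 < n by lia.
(* Below the box the letters exceed [x]. In columns to the right, the row order excludes row [r],
   row and column order together exclude lower rows, and the induction hypothesis excludes higher
   rows. *)
have fin q : (x.-1, q) \notin rd_post T (r, c).
  case: q => r' c'; apply/negP => /(mem_rd_post hT) /= [yq [cc'|[ec rr']]]; last first.
    by subst c'; have := box_col hla hT xp yq rr'; lia.
  have h := IH _ _ _ x1 yq.
  have lt' : c < nth 0 la r' by apply: leq_trans (box_in_shape hT yq); exact: ltnW.
  have zq := mem_head0 (box_ne hT lt').
  have h2 := box_row hT zq yq cc'.
  have [rr'|r'r|er] := ltngtP r r'; last by subst r'; have := box_row hT xp yq cc'; lia.
    by have := box_col hla hT xp zq rr'; lia.
  by lia.
have sp := box_sorted hT r c.
have := yT; rewrite (mv_rd_split hS lts).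
case Eb: (box T (r, c)) xp sp => [|y s] // xp sp /=.
rewrite word_of_cat => /yamanouchi_suffix /=.
rewrite word_of_cat word_of_cat word_of_tag_letters => yam.
have min := allP (order_path_min leq_trans sp).
have [exy|nxy] := eqVneq x y.
  subst y; have := yamanouchi_pred yam (leq_ltn_trans (ltn0Sn r) rx).
  rewrite !mem_cat => /or3P[/mem_word_of[[r' c'] /(mem_rd_mid hT)[/= yq _ rr']]|/min|].
  - by have := IH _ _ _ x1 yq; lia.
  - by lia.
  - by case/mem_word_of=> q; apply/negP.
move: xp; rewrite inE (negPf nxy) /= => /splitPr xs.
case: xs Eb sp min yam => s1 s2 _ sp _.
move=> yam; have {}yam : yamanouchi (x :: s2 ++ word_of (rd_post T (r, c))).
  apply: (@yamanouchi_suffix (y :: word_of (rd_mid T (r, c)) ++ s1)).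
  move: yam; move: (word_of (rd_mid _ _)) (word_of (rd_post _ _)) => M P.
  by rewrite /= -!catA.
have := yamanouchi_pred yam (leq_ltn_trans (ltn0Sn r) rx).
rewrite mem_cat => /orP[xs2|/mem_word_of[q]]; last exact/negP.
have /path_sorted := sp; rewrite sorted_cat_cons => /andP[_].
by move=> /(order_path_min leq_trans)/allP/(_ _ xs2); lia.
Qed.

End Injectivity.

(** Of two different positions, the [i.+1] at the earlier one would be uncancelled in the word
    before the later one. *)
Lemma wordF_inj i w w1 w2 : wordF i w1 w -> wordF i w2 w -> w1 = w2.
Proof.
have aux u v u' v' v1 : eps i u = 0 -> phi i v = 0 -> eps i u' = 0 ->
    u' = u ++ i.+1 :: v1 -> v = v1 ++ i.+1 :: v' -> False.
  move=> eu pv eu' e1 e2; move: eu' pv; rewrite e1 e2 eps_cat phi_cat eu /= eqxx.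
  by case: eqP; lia.
move=> [u [v [-> -> eu pv]]] [u' [v' [-> e eu' pv']]].
case: (cat_cons_split e) => [[v1 e1 e2]|[[|x u1] e1]].
- by case: (aux _ _ _ _ _ eu pv eu' e1 e2).
- by rewrite e1 cats0 => -[->].
- by move=> [ex e2]; subst x; case: (aux _ _ _ _ _ eu' pv' eu e1 e2).
Qed.

(** * Highest weight elements *)

Lemma count_mem_rows (ss : seq (seq nat)) k :
  (forall r, {in nth [::] ss r, forall x, x = k + r}) -> forall j,
  count_mem j (flatten ss) = if k <= j then nth 0 (map size ss) (j - k) else 0.
Proof.
elim: ss k => [|s ss IH] k h j; first by rewrite nth_nil if_same.
have es : s = nseq (size s) k.
  by apply/all_pred1P/allP => x /(h 0); rewrite addn0 => ->; exact/eqP.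
rewrite /= count_cat {1}es count_nseq /= (IH k.+1); last first.
  by move=> r x xs; rewrite addSnnS; exact: (h r.+1).
have [kj|jk|->] := ltngtP k j.
- by rewrite mul0n add0n (_ : j - k = (j - k.+1).+1) //; lia.
- by rewrite mul0n.
- by rewrite subnn /= mul1n addn0.
Qed.

Definition row_content (T : mvtab) : seq nat := [seq size (flatten s) | s <- T].

Lemma hw_weight la T : is_partition la -> MVT_inf la T ->
  yamanouchi (word_of (mv_rd T)) ->
  [/\ is_partition (row_content T), weight_is (mv_wt T) (row_content T),
      part_incl la (row_content T) & size (row_content T) = size la].
Proof.
move=> hla hT yT; have es := MVT_shape hT.
have sz : size (row_content T) = size la by rewrite -es !size_map.
have boxE r x : x \in nth [::] (map flatten T) r -> x = 1 + r.
  have [lt|ge] := ltnP r (size T); last by rewrite nth_default ?size_map.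
  rewrite (nth_map [::]) // => /flattenP[s sr xs].
  have := nth_index [::] sr; set c := index s _ => es'.
  by apply: (hw_box (c := c) hla hT yT); rewrite /box /= es'.
have wt : weight_is (mv_wt T) (row_content T).
  move=> j; rewrite /mv_wt mset_seqE /mv_letters.
  have -> : flatten (flatten T) = flatten (map flatten T).
    by elim: (T) => //= s t IH; rewrite flatten_cat IH.
  rewrite (count_mem_rows (k := 1) boxE) -map_comp.
  by case: j => // j; rewrite /= subn1.
have incl : part_incl la (row_content T).
  move=> r; have [lt|ge] := ltnP r (size la); last first.
    by rewrite !nth_default // sz.
  have ltT : r < size T by rewrite -es size_map in lt.
  rewrite -es nth_shape (nth_map [::]) //.
  have : {in nth [::] T r, forall b, 0 < size b}.
    move=> b br; have := nth_index [::] br; set c := index b _ => eb.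
    have /(box_ne hT) : c < nth 0 la r by rewrite -es nth_shape index_mem.
    by rewrite /box /= eb lt0n size_eq0 => /eqP.
  elim: (nth [::] T r) => //= b s IH h; rewrite size_cat.
  have h' : {in s, forall x, 0 < size x}.
    by move=> x xs; apply: h; rewrite inE xs orbT.
  by have := h b (mem_head _ _); have := IH h'; lia.
split=> //; split.
  (* With [eps] zero, [phi_eps_count] bounds the number of letters [r.+2] by that of letters
     [r.+1]. *)
  apply/(sortedP 0) => r lt /=.
  have := yT r.+1 isT; have := phi_eps_count r.+1 (word_of (mv_rd T)).
  rewrite !(permP (perm_mv_rd hla hT)) -!mset_seqE -/(mv_wt T) !wt /=; lia.
apply/negP => /(nthP 0)[r]; rewrite sz => lt e0.
have := incl r; rewrite e0 leqn0 => /eqP e1; case: hla => _ /negP[].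
by rewrite -e1 mem_nth.
Qed.

Lemma mv_e_None i T : mv_e i T = None <-> eps i (word_of (mv_rd T)) = 0.
Proof.
rewrite /mv_e; have := leftmost_minusP i (mv_rd T).
case: leftmost_minus => [[r c] [u [v [-> eu pv]]]|//]; split=> //.
by rewrite word_of_cat eps_cat /= eqxx pv.
Qed.

Lemma mv_f_None i T : mv_f i T = None <-> phi i (word_of (mv_rd T)) = 0.
Proof.
rewrite /mv_f; have := rightmost_plusP i (mv_rd T).
case: rightmost_plus => [[r c] [u [v [-> eu pv]]]|//]; split=> //.
by rewrite word_of_cat phi_cat eu /= eqxx (_ : i == i.+1 = false) //; lia.
Qed.

Lemma rdF_wordF i T T' : rdF i T T' -> wordF i (word_of (mv_rd T)) (word_of (mv_rd T')).
Proof.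
move=> [u [v [p [p' [-> -> _ eu pv]]]]].
by exists (word_of u), (word_of v); rewrite !word_of_cat.
Qed.

Lemma rdF_cols i T T' : rdF i T T' ->
  [seq x.2.2 | x <- mv_rd T] = [seq x.2.2 | x <- mv_rd T'].
Proof. by move=> [u [v [p [p' [-> -> e _ _]]]]]; rewrite !map_cat /= e. Qed.

(** Going forth and back restores the word and the columns of its letters, and these determine the
    tableau. *)
Lemma mv_fK la i T T' : is_partition la -> MVT_inf la T -> 0 < i ->
  mv_f i T = Some T' -> mv_e i T' = Some T.
Proof.
move=> hla hT i0 /(mv_fP hla hT)[hT' F].
case E: (mv_e i T') => [T''|]; last first.
  by have /mv_e_None e0 := E; have := wordF_eps (rdF_wordF F); rewrite e0.
have [hT'' F'] := mv_eP hla hT' i0 E.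
congr Some; apply: (mv_rd_inj hla) => //.
  exact: wordF_inj (rdF_wordF F') (rdF_wordF F).
by rewrite (rdF_cols F') (rdF_cols F).
Qed.

Lemma mv_eK la i T T' : is_partition la -> MVT_inf la T -> 0 < i ->
  mv_e i T = Some T' -> mv_f i T' = Some T.
Proof.
move=> hla hT i0 /(mv_eP hla hT i0)[hT' F].
case E: (mv_f i T') => [T''|]; last first.
  by have /mv_f_None e0 := E; have := wordF_phi (rdF_wordF F); rewrite e0.
have [hT'' F'] := mv_fP hla hT' E.
congr Some; apply: (mv_rd_inj hla) => //.
  exact: wordF_fun (rdF_wordF F') (rdF_wordF F).
by rewrite -(rdF_cols F') -(rdF_cols F).
Qed.

(** * Crystals governed by reading words *)

(** A common interface for multiset-valued and semistandard tableaux. Injectivity of [rd] is left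
    out because it fails for the former; it is imposed later, on single components. *)
Record word_crystal (n : nat) (B : crystal) (rd : cr_sort B -> seq nat) : Prop :=
  WordCrystal {
    wc_e : forall i b b', 0 < i < n -> cr_set B b -> cr_e i b = Some b' ->
      cr_set B b' /\ wordF i (rd b') (rd b);
    wc_f : forall i b b', 0 < i < n -> cr_set B b -> cr_f i b = Some b' ->
      cr_set B b' /\ wordF i (rd b) (rd b');
    wc_e0 : forall i b, 0 < i < n -> cr_set B b ->
      cr_e i b = None <-> eps i (rd b) = 0;
    wc_f0 : forall i b, 0 < i < n -> cr_set B b ->
      cr_f i b = None <-> phi i (rd b) = 0;
    wc_eK : forall i b b', 0 < i < n -> cr_set B b -> cr_e i b = Some b' ->
      cr_f i b' = Some b;
    wc_fK : forall i b b', 0 < i < n -> cr_set B b -> cr_f i b = Some b' ->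
      cr_e i b' = Some b;
    wc_wt : forall b, cr_set B b -> cr_wt b = seq_mset (rd b) }.

Section WordCrystal.
Variables (n : nat) (B : crystal) (rd : cr_sort B -> seq nat).
Hypothesis wB : word_crystal n rd.

Lemma wc_stable : cr_stable n B.
Proof. by move=> i b b' ni bB [/(wc_e wB ni bB)|/(wc_f wB ni bB)] []. Qed.

Lemma wc_generated (b0 b : cr_sort B) : cr_set B b0 -> generated n b0 b -> cr_set B b.
Proof.
by move=> b0B; elim=> // i b1 b2 ni _ b1B E; apply: (wc_stable ni b1B); [left|right].
Qed.

Lemma wc_closure_stable (b0 : cr_sort B) : cr_stable n (cr_closure n b0).
Proof.
move=> i b b' ni gb [E|E]; first exact: GeneratedE ni gb E.
exact: GeneratedF ni gb E.
Qed.

Lemma generated_trans (b0 b1 b2 : cr_sort B) :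
  generated n b0 b1 -> generated n b1 b2 -> @generated n B b0 b2.
Proof.
move=> g01; elim=> // i b b' ni _ gb E; first exact: GeneratedE ni gb E.
exact: GeneratedF ni gb E.
Qed.

Lemma wc_generated_sym (b0 b1 : cr_sort B) : cr_set B b0 ->
  generated n b0 b1 -> generated n b1 b0.
Proof.
move=> b0B; elim=> [|i b b' ni gb IH E|i b b' ni gb IH E].
- exact: Generated0.
- have E' := wc_eK wB ni (wc_generated b0B gb) E.
  exact: generated_trans (GeneratedF ni (Generated0 n b') E') IH.
- have E' := wc_fK wB ni (wc_generated b0B gb) E.
  exact: generated_trans (GeneratedE ni (Generated0 n b') E') IH.
Qed.

(** Each [e_i] lowers the sum of the letters by one, so climbing stops; the [f_i] lead back. *)
Lemma wc_highest (b : cr_sort B) : cr_set B b ->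
  exists2 h, highest_weight n h & generated n h b.
Proof.
have [m] := ubnP (sumn (rd b)); elim: m b => // m IH b lt bB.
have [[i [b' [ni E]]]|no] := pselect (exists i b', 0 < i < n /\ cr_e i b = Some b').
  have [b'B /wordF_sum eb] := wc_e wB ni bB E.
  have [|h hw gh] := IH b' _ b'B; first by rewrite eb in lt.
  by exists h => //; apply: GeneratedF ni gh (wc_eK wB ni bB E).
exists b; last exact: Generated0.
split=> // i ni; case E: (cr_e i b) => [b'|] //.
by case: no; exists i, b'.
Qed.

End WordCrystal.

(** * Isomorphic components *)

(** Both crystals follow their words step by step and [P] respects the steps. So each [a] has a
    partner whose word is [P (ra a)], unique by injectivity on the component. *)
Lemma wc_closure_iso n (A B : crystal) ra rb (a0 : cr_sort A) (b0 : cr_sort B) :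
  word_crystal n ra -> word_crystal n rb -> cr_set A a0 -> cr_set B b0 ->
  (forall a a', generated n a0 a -> generated n a0 a' -> ra a = ra a' -> a = a') ->
  (forall b b', generated n b0 b -> generated n b0 b' -> rb b = rb b' -> b = b') ->
  plactic (ra a0) (rb b0) ->
  crystal_iso n (cr_closure n a0) (cr_closure n b0).
Proof.
move=> wA wB a0A b0B injA injB [P [Q [PK QK [PF Pp Pe Ps] [QF Qp Qe Qs] Pab]]].
have gA a : generated n a0 a -> cr_set A a by exact: (wc_generated wA a0A).
have gB b : generated n b0 b -> cr_set B b by exact: (wc_generated wB b0B).
have fstep i a a' b : 0 < i < n -> generated n a0 a -> generated n b0 b ->
    rb b = P (ra a) -> cr_f i a = Some a' ->
    exists b', [/\ cr_f i b = Some b', generated n b0 b' & rb b' = P (ra a')].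
  move=> ni ga gb e E; have [a'A F] := wc_f wA ni (gA _ ga) E.
  case E' : (cr_f i b) => [b'|]; last first.
    have /(wc_f0 wB ni (gB _ gb)) := E'; rewrite e Pp.
    by have := wordF_phi F; case: phi.
  exists b'; split=> //; first exact: GeneratedF ni gb E'.
  have [_ F'] := wc_f wB ni (gB _ gb) E'.
  by rewrite e in F'; exact: wordF_fun F' (PF _ _ _ F).
have estep i a a' b : 0 < i < n -> generated n a0 a -> generated n b0 b ->
    rb b = P (ra a) -> cr_e i a = Some a' ->
    exists b', [/\ cr_e i b = Some b', generated n b0 b' & rb b' = P (ra a')].
  move=> ni ga gb e E; have [a'A F] := wc_e wA ni (gA _ ga) E.
  case E' : (cr_e i b) => [b'|]; last first.
    have /(wc_e0 wB ni (gB _ gb)) := E'; rewrite e Pe.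
    by have := wordF_eps F; case: eps.
  exists b'; split=> //; first exact: GeneratedE ni gb E'.
  have [_ F'] := wc_e wB ni (gB _ gb) E'.
  by rewrite e in F'; exact: wordF_inj F' (PF _ _ _ F).
have ex a : generated n a0 a -> exists b, generated n b0 b /\ rb b = P (ra a).
  elim=> [|i a1 a2 ni ga [b [gb e]] E|i a1 a2 ni ga [b [gb e]] E].
  - by exists b0; split=> //; exact: Generated0.
  - by have [b' [_ gb' e']] := estep _ _ _ _ ni ga gb e E; exists b'.
  - by have [b' [_ gb' e']] := fstep _ _ _ _ ni ga gb e E; exists b'.
have [psi psiP] : {psi : cr_sort A -> cr_sort B | forall a, generated n a0 a ->
    generated n b0 (psi a) /\ rb (psi a) = P (ra a)}.
  exists (fun a => if pselect (exists b, generated n b0 b /\ rb b = P (ra a))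
                   is left h then sval (cid h) else b0).
  by move=> a /ex h; case: pselect => // h'; exact: svalP (cid h').
split; [exact: wc_closure_stable|exact: wc_closure_stable|exists psi].
have psi_f i a a' : 0 < i < n -> generated n a0 a -> cr_f i a = Some a' ->
    cr_f i (psi a) = Some (psi a').
  move=> ni ga E; have [gp ep] := psiP a ga.
  have [b' [E' gb' eb']] := fstep _ _ _ _ ni ga gp ep E.
  have [gp' ep'] := psiP a' (GeneratedF ni ga E).
  by rewrite E'; congr Some; apply: injB => //; rewrite eb' ep'.
have psi_e i a a' : 0 < i < n -> generated n a0 a -> cr_e i a = Some a' ->
    cr_e i (psi a) = Some (psi a').
  move=> ni ga E; have [gp ep] := psiP a ga.
  have [b' [E' gb' eb']] := estep _ _ _ _ ni ga gp ep E.
  have [gp' ep'] := psiP a' (GeneratedE ni ga E).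
  by rewrite E'; congr Some; apply: injB => //; rewrite eb' ep'.
split.
- split.
  + by move=> a /psiP[].
  + move=> a a'; rewrite !inE /= => ga ga' e; apply: injA => //.
    by apply: (can_inj PK); rewrite -(psiP a ga).2 -(psiP a' ga').2 e.
  + move=> b /=; elim=> [|i b1 b2 ni gb [a ga eb] E|i b1 b2 ni gb [a ga eb] E].
    * exists a0; first exact: Generated0.
      have [gp ep] := psiP a0 (Generated0 n a0).
      by apply: injB => //; [exact: Generated0|rewrite ep].
    * subst b1; case E' : (cr_e i a) => [a'|].
        exists a'; first exact: GeneratedE ni ga E'.
        by have := psi_e _ _ _ ni ga E'; rewrite E => -[].
      have /(wc_e0 wA ni (gA _ ga)) := E'; rewrite -(Pe i) -(psiP a ga).2.
      by move/(wc_e0 wB ni (gB _ gb)); rewrite E.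
    * subst b1; case E' : (cr_f i a) => [a'|].
        exists a'; first exact: GeneratedF ni ga E'.
        by have := psi_f _ _ _ ni ga E'; rewrite E => -[].
      have /(wc_f0 wA ni (gA _ ga)) := E'; rewrite -(Pp i) -(psiP a ga).2.
      by move/(wc_f0 wB ni (gB _ gb)); rewrite E.
- move=> a /= ga; have [gp ep] := psiP a ga.
  rewrite (wc_wt wB (gB _ gp)) (wc_wt wA (gA _ ga)) ep.
  exact/eq_seq_msetP/Ps.
- move=> i a ni /= ga; case E: (cr_e i a) => [a'|] /=; first exact: psi_e.
  apply/(wc_e0 wB ni); first by apply: gB; case: (psiP a ga).
  by rewrite (psiP a ga).2 Pe; apply/(wc_e0 wA ni (gA _ ga)).
- move=> i a ni /= ga; case E: (cr_f i a) => [a'|] /=; first exact: psi_f.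
  apply/(wc_f0 wB ni); first by apply: gB; case: (psiP a ga).
  by rewrite (psiP a ga).2 Pp; apply/(wc_f0 wA ni (gA _ ga)).
Qed.

Lemma MVT_bound n la T : is_partition la -> MVT_inf la T ->
  MVT n la T <-> {in word_of (mv_rd T), forall x, x <= n}.
Proof.
move=> hla hT; have e := perm_mem (perm_mv_rd hla hT).
by split=> [[_ h] x|h]; [rewrite e; exact: h|split=> // x; rewrite -e; exact: h].
Qed.

Lemma MVT_word_crystal n la : is_partition la ->
  @word_crystal n (MVT_crystal n la) (fun T => word_of (mv_rd T)).
Proof.
move=> hla; split=> /=.
- move=> i T T' /andP[i0 ni] [hT bT] E.
  have [hT' F] := mv_eP hla hT i0 E; split; last exact: rdF_wordF.
  apply/(MVT_bound _ hla hT') => x.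
  have /(MVT_bound _ hla hT) {}bT : MVT n la T by [].
  have [u [v [e1 e2 _ _]]] := rdF_wordF F; rewrite e2 in bT; rewrite e1.
  rewrite mem_cat inE => /or3P[xu|/eqP->|xv]; last 1 first.
  + by apply: bT; rewrite mem_cat inE xv !orbT.
  + by apply: bT; rewrite mem_cat xu.
  + exact: ltnW.
- move=> i T T' /andP[i0 ni] [hT bT] E.
  have [hT' F] := mv_fP hla hT E; split; last exact: rdF_wordF.
  apply/(MVT_bound _ hla hT') => x.
  have /(MVT_bound _ hla hT) {}bT : MVT n la T by [].
  have [u [v [e1 e2 _ _]]] := rdF_wordF F; rewrite e1 in bT; rewrite e2.
  rewrite mem_cat inE => /or3P[xu|/eqP->|xv] //.
  + by apply: bT; rewrite mem_cat xu.
  + by apply: bT; rewrite mem_cat inE xv !orbT.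
- by move=> i T _ _; exact: mv_e_None.
- by move=> i T _ _; exact: mv_f_None.
- by move=> i T T' /andP[i0 _] [hT _]; exact: (mv_eK hla hT i0).
- by move=> i T T' /andP[i0 _] [hT _]; exact: (mv_fK hla hT i0).
- by move=> T [hT _]; apply/eq_seq_msetP; rewrite perm_sym (perm_mv_rd hla hT).
Qed.

(** [highest_weight] tests only [i < n]; for [i >= n] there is no letter [i.+1] that could remain
    uncancelled. *)
Lemma hw_yamanouchi n la T : is_partition la ->
  @highest_weight n (MVT_crystal n la) T <->
  MVT n la T /\ yamanouchi (word_of (mv_rd T)).
Proof.
move=> hla; split=> [[hT e0]|[hT yT]]; split=> //; last first.
  by move=> i /andP[i0 _]; apply/mv_e_None/yT.
move=> i i0; have [ni|ni] := ltnP i n.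
  by apply/mv_e_None/e0; rewrite i0.
have [hT' _] := hT; have /(MVT_bound _ hla hT') b := hT.
by apply: eps_notin; apply/negP => /b; rewrite ltnNge ni.
Qed.

(** * Semistandard tableaux as tableaux with one-letter boxes *)

Definition singleton_tab (t : tab) : mvtab := [seq [seq [:: x] | x <- s] | s <- t].

Lemma singleton_tab_inj : injective singleton_tab.
Proof. by apply: inj_map; apply: inj_map => x y []. Qed.

Lemma shape_singleton t : shape (singleton_tab t) = shape t.
Proof. by rewrite /shape -map_comp; apply: eq_map => s /=; rewrite size_map. Qed.

Lemma nth_shape_tab (t : tab) r : nth 0 (shape t) r = size (nth [::] t r).
Proof.
have [lt|ge] := ltnP r (size t); first by rewrite (nth_map [::]).
by rewrite !nth_default ?size_map.
Qed.

Lemma box_singleton t r c : c < nth 0 (shape t) r ->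
  box (singleton_tab t) (r, c) = [:: entry t (r, c)].
Proof.
move=> lt; have rs := part_size lt; rewrite size_map in rs.
rewrite nth_shape_tab in lt.
by rewrite /box /entry /= (nth_map [::]) // (nth_map 0).
Qed.

Lemma mv_letters_singleton t : mv_letters (singleton_tab t) = flatten t.
Proof.
rewrite /mv_letters; elim: t => //= s t IH; rewrite flatten_cat -IH; congr cat.
by elim: s => //= x s ->.
Qed.

Lemma tab_wt_singleton t : mv_wt (singleton_tab t) = tab_wt t.
Proof. by rewrite /mv_wt mv_letters_singleton. Qed.

Lemma SSYT_inf_singleton mu t : is_partition mu ->
  SSYT_inf mu t <-> MVT_inf mu (singleton_tab t).
Proof.
move=> hmu; split=> [[es h1 h2 h3]|[es h1 h2 h3]].
  have bs r c : c < nth 0 mu r -> box (singleton_tab t) (r, c) = [:: entry t (r, c)].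
    by move=> lt; rewrite box_singleton ?es.
  split; first by rewrite shape_singleton.
  - move=> r c lt; rewrite bs //; split=> // x; rewrite inE => /eqP->; exact: h1.
  - by move=> r c lt; rewrite !bs //; [exact: h2|exact: ltnW].
  - move=> r c lt; rewrite !bs //; first exact: h3.
    exact: leq_trans lt (part_nth_le hmu (leqnSn r)).
rewrite shape_singleton in es.
have bs r c : c < nth 0 mu r -> box (singleton_tab t) (r, c) = [:: entry t (r, c)].
  by move=> lt; rewrite box_singleton ?es.
split=> //.
- by move=> r c lt; have [_ _] := h1 r c lt; rewrite bs //; apply; rewrite mem_head.
- by move=> r c lt; have := h2 r c lt; rewrite !bs //; exact: ltnW.
- move=> r c lt; have := h3 r c lt; rewrite !bs //.
  exact: leq_trans lt (part_nth_le hmu (leqnSn r)).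
Qed.

Lemma SSYT_singleton n mu t : is_partition mu -> SSYT n mu t <-> MVT n mu (singleton_tab t).
Proof.
move=> hmu; rewrite /SSYT /MVT /= mv_letters_singleton.
by split=> -[/(SSYT_inf_singleton _ hmu) ? ?].
Qed.

Lemma mv_rd_singleton t : mv_rd (singleton_tab t) = tab_rd t.
Proof.
rewrite /mv_rd /tab_rd shape_singleton; congr flatten; apply/eq_in_map => c _.
rewrite /mv_rd_col shape_singleton -/(rd_rest _ _).
have bs q : q \in column (shape t) c -> box (singleton_tab t) q = [:: entry t q].
  by case: q => r c'; rewrite mem_column => /andP[_ /box_singleton].
have -> : rd_rest (singleton_tab t) (column (shape t) c) = [::].
  by apply: flatten_map_nil => q /bs ->.
by rewrite cats0; apply/eq_in_map => q; rewrite mem_rev => /bs ->.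
Qed.

Lemma set_box_singleton t p x : p.2 < nth 0 (shape t) p.1 ->
  set_box (singleton_tab t) p [:: x] = singleton_tab (set_entry t p x).
Proof.
case: p => r c /= lt; have rs := part_size lt; rewrite size_map in rs.
have lt' : c < size (nth [::] t r) by rewrite -nth_shape_tab.
rewrite /set_box /set_entry /singleton_tab /=; apply: (@eq_from_nth _ [::]).
  by rewrite !(size_set_nth, size_map).
move=> r'; rewrite size_set_nth size_map (maxn_idPr rs) => lt1.
rewrite nth_set_nth /= [RHS](nth_map [::]) ?size_set_nth ?(maxn_idPr rs) //.
rewrite nth_set_nth /=; case: eqP => [er|_]; last by rewrite (nth_map [::]).
rewrite (nth_map [::]) //; apply: (@eq_from_nth _ [::]).
  by rewrite !(size_set_nth, size_map).
move=> c'; rewrite size_set_nth size_map (maxn_idPr lt') => lt2.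
rewrite nth_set_nth /= [RHS](nth_map 0) ?size_set_nth ?(maxn_idPr lt') //.
by rewrite nth_set_nth /=; case: eqP => // _; rewrite (nth_map 0).
Qed.

(* The operators never empty a box, so on one-letter boxes they only replace
   the letter. *)
Lemma tab_e_singleton mu i t : is_partition mu -> SSYT_inf mu t -> 0 < i ->
  mv_e i (singleton_tab t) = omap singleton_tab (tab_e i t).
Proof.
move=> hmu /(SSYT_inf_singleton _ hmu) hT i0.
case E: (mv_e i (singleton_tab t)) => [T'|]; last first.
  move: E; rewrite /mv_e /tab_e -mv_rd_singleton.
  by case: leftmost_minus => // -[r c].
have [hT' _] := mv_eP hmu hT i0 E; rewrite -E.
move: E; rewrite /mv_e /tab_e -mv_rd_singleton.
have := leftmost_minusP i (mv_rd (singleton_tab t)).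
case: leftmost_minus => [[r c] [u [v [e _ _]]]|//].
have ip : i.+1 \in box (singleton_tab t) (r, c).
  by rewrite -(mem_mv_rd hmu hT) e mem_cat mem_head orbT.
have lt := box_in_shape hT ip.
have lts : c < nth 0 (shape t) r by rewrite -shape_singleton (MVT_shape hT).
move: ip; rewrite box_singleton // inE => /eqP ei; rewrite -ei.
case: ifP => [/andP[r0 _] [eT]|_ _].
  have := box_ne hT' lt; rewrite -eT !box_set_box /= eqxx xpair_eqE eqxx andbT.
  by rewrite (_ : r == r.-1 = false) /= ?eqxx; last lia; case.
by rewrite /= eqxx /mset_add /= -set_box_singleton.
Qed.

Lemma tab_f_singleton mu i t : is_partition mu -> SSYT_inf mu t ->
  mv_f i (singleton_tab t) = omap singleton_tab (tab_f i t).
Proof.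
move=> hmu /(SSYT_inf_singleton _ hmu) hT.
case E: (mv_f i (singleton_tab t)) => [T'|]; last first.
  move: E; rewrite /mv_f /tab_f -mv_rd_singleton.
  by case: rightmost_plus => // -[r c].
have [hT' _] := mv_fP hmu hT E; rewrite -E.
move: E; rewrite /mv_f /tab_f -mv_rd_singleton.
have := rightmost_plusP i (mv_rd (singleton_tab t)).
case: rightmost_plus => [[r c] [u [v [e _ _]]]|//].
have ip : i \in box (singleton_tab t) (r, c).
  by rewrite -(mem_mv_rd hmu hT) e mem_cat mem_head orbT.
have lt := box_in_shape hT ip.
have lts : c < nth 0 (shape t) r by rewrite -shape_singleton (MVT_shape hT).
move: ip; rewrite (box_singleton lts) inE => /eqP ei; rewrite -ei.
case: ifP => [_ [eT]|_ _].
  have := box_ne hT' lt; rewrite -eT !box_set_box /= eqxx xpair_eqE eqxx andbT.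
  by rewrite (_ : r == r.+1 = false) /= ?eqxx; last lia; case.
by rewrite /= eqxx /mset_add /= -set_box_singleton.
Qed.

Lemma SSYT_word_crystal n mu : is_partition mu ->
  @word_crystal n (hw_crystal n mu) (fun t => word_of (tab_rd t)).
Proof.
move=> hmu; have [M1 M2 M3 M4 M5 M6 M7] := MVT_word_crystal n hmu.
rewrite /= in M1 M2 M3 M4 M5 M6 M7.
have se i t t' : 0 < i < n -> SSYT n mu t -> tab_e i t = Some t' ->
    mv_e i (singleton_tab t) = Some (singleton_tab t').
  by move=> /andP[i0 _] [ht _] E; rewrite (tab_e_singleton hmu ht i0) E.
have sf i t t' : 0 < i < n -> SSYT n mu t -> tab_f i t = Some t' ->
    mv_f i (singleton_tab t) = Some (singleton_tab t').
  by move=> /andP[i0 _] [ht _] E; rewrite (tab_f_singleton i hmu ht) E.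
split=> /=.
- move=> i t t' ni ht E; have /(SSYT_singleton _ _ hmu) hT := ht.
  have [/(SSYT_singleton _ _ hmu)] := M1 _ _ _ ni hT (se _ _ _ ni ht E).
  by rewrite !mv_rd_singleton.
- move=> i t t' ni ht E; have /(SSYT_singleton _ _ hmu) hT := ht.
  have [/(SSYT_singleton _ _ hmu)] := M2 _ _ _ ni hT (sf _ _ _ ni ht E).
  by rewrite !mv_rd_singleton.
- move=> i t /andP[i0 _] [ht _]; rewrite -mv_rd_singleton -mv_e_None.
  by rewrite (tab_e_singleton hmu ht i0); case: tab_e.
- move=> i t /andP[i0 _] [ht _]; rewrite -mv_rd_singleton -mv_f_None.
  by rewrite (tab_f_singleton i hmu ht); case: tab_f.
- move=> i t t' ni ht E; have /(SSYT_singleton _ _ hmu) hT := ht.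
  have E' := se _ _ _ ni ht E; have [/(SSYT_singleton _ _ hmu)[ht' _] _] := M1 _ _ _ ni hT E'.
  have := M5 _ _ _ ni hT E'; rewrite (tab_f_singleton i hmu ht').
  by case: tab_f => //= t'' [/singleton_tab_inj->].
- move=> i t t' ni ht E; have /(SSYT_singleton _ _ hmu) hT := ht.
  have E' := sf _ _ _ ni ht E; have [/(SSYT_singleton _ _ hmu)[ht' _] _] := M2 _ _ _ ni hT E'.
  have := M6 _ _ _ ni hT E'; case/andP: ni => i0 _; rewrite (tab_e_singleton hmu ht' i0).
  by case: tab_e => //= t'' [/singleton_tab_inj->].
- by move=> t /(SSYT_singleton _ _ hmu)/M7; rewrite tab_wt_singleton mv_rd_singleton.
Qed.

(** With one letter per box the column labels depend on the shape alone, so the word suffices. *)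
Lemma tab_rd_inj mu t t' : is_partition mu -> SSYT_inf mu t -> SSYT_inf mu t' ->
  word_of (tab_rd t) = word_of (tab_rd t') -> t = t'.
Proof.
move=> hmu ht ht' e; apply: singleton_tab_inj.
have [es _ _ _] := ht; have [es' _ _ _] := ht'.
have /(SSYT_inf_singleton _ hmu) hT := ht; have /(SSYT_inf_singleton _ hmu) hT' := ht'.
apply: (mv_rd_inj hmu hT hT'); rewrite !mv_rd_singleton //.
rewrite /tab_rd es es' !map_flatten -!map_comp; congr flatten.
by apply: eq_map => c /=; rewrite -!map_comp.
Qed.

Lemma highest_singleton n mu t : is_partition mu ->
  @highest_weight n (hw_crystal n mu) t ->
  @highest_weight n (MVT_crystal n mu) (singleton_tab t).
Proof.
move=> hmu [ht e0]; split=> /=; first exact/SSYT_singleton.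
move=> i ni; have /andP[i0 _] := ni; have [ht' _] := ht.
by have /= e := e0 i ni; rewrite (tab_e_singleton hmu ht' i0) e.
Qed.

Lemma highest_entry n mu t r c : is_partition mu ->
  @highest_weight n (hw_crystal n mu) t -> c < nth 0 mu r -> entry t (r, c) = r.+1.
Proof.
move=> hmu /(highest_singleton hmu)/(hw_yamanouchi _ hmu)[[hT _] yT] lt.
apply: (hw_box (c := c) hmu hT yT); rewrite box_singleton ?mem_head //.
by rewrite -shape_singleton (MVT_shape hT).
Qed.

Lemma highest_tab_uniq n mu t t' : is_partition mu ->
  @highest_weight n (hw_crystal n mu) t -> @highest_weight n (hw_crystal n mu) t' ->
  t = t'.
Proof.
move=> hmu ht ht'; have [[[es _ _ _] _] _] := ht; have [[[es' _ _ _] _] _] := ht'.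
apply/singleton_tab_inj/mvtab_eq; rewrite !shape_singleton ?es ?es' // => r c lt.
by rewrite !box_singleton ?es ?es' // !(highest_entry (n := n) hmu).
Qed.

(** It is enough to exhibit some element of [SSYT n mu], since climbing by the [e_i] ends at a
    highest weight one. *)
Lemma highest_tab_ex n mu : is_partition mu -> size mu <= n ->
  exists t, @highest_weight n (hw_crystal n mu) t.
Proof.
move=> hmu le_mn.
pose t0 : tab := [seq nseq (nth 0 mu r) r.+1 | r <- iota 0 (size mu)].
have nthr r : r < size mu -> nth [::] t0 r = nseq (nth 0 mu r) r.+1.
  by move=> lt; rewrite (nth_map 0) ?size_iota // nth_iota.
have es : shape t0 = mu.
  rewrite /shape -map_comp -[RHS](mkseq_nth 0); apply: eq_map => r /=.
  by rewrite size_nseq.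
have ent r c : c < nth 0 mu r -> entry t0 (r, c) = r.+1.
  by move=> lt; rewrite /entry /= nthr ?(part_size lt) // nth_nseq lt.
have ht0 : SSYT n mu t0.
  split; first split=> //.
  - by move=> r c lt; rewrite ent.
  - by move=> r c lt; rewrite !ent // ltnW.
  - move=> r c lt; rewrite !ent //.
    exact: leq_trans lt (part_nth_le hmu (leqnSn r)).
  move=> x /flattenP[s /mapP[r]]; rewrite mem_iota /= add0n => lt ->.
  by rewrite mem_nseq => /andP[_ /eqP->]; exact: leq_trans lt le_mn.
by have [h hw _] := wc_highest (SSYT_word_crystal n hmu) ht0; exists h.
Qed.

(** Every element climbs to a highest weight element, and there is only one: the crystal is
    connected. *)
Lemma generated_SSYT n mu t : is_partition mu ->
  @highest_weight n (hw_crystal n mu) t ->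
  @generated n (hw_crystal n mu) t = SSYT n mu.
Proof.
move=> hmu ht; have wS := SSYT_word_crystal n hmu.
apply/seteqP; split=> t' /=; first exact: (wc_generated wS ht.1).
move=> /(wc_highest wS)[h hw]; rewrite (highest_tab_uniq hmu ht hw); exact.
Qed.

Lemma closure_hw_iso n la T : is_partition la ->
  @highest_weight n (MVT_crystal n la) T ->
  exists2 t, @highest_weight n (hw_crystal n (row_content T)) t &
  crystal_iso n (@cr_closure n (MVT_crystal n la) T)
                (hw_crystal n (row_content T)).
Proof.
move=> hla hw; have /(hw_yamanouchi _ hla)[hT yT] := hw.
have [hTi bT] := hT.
have [hmu wt incl sz] := hw_weight hla hTi yT; set mu := row_content T in hmu wt incl sz *.
(* The number of parts of [la] is a letter of the last row. *)
have le_mn : size mu <= n.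
  rewrite sz; case E: (size la) => [//|k]; have klt : k < size la by rewrite E.
  have lt : 0 < nth 0 la k.
    by rewrite lt0n; apply: contraTneq (mem_nth 0 klt) => ->; case: hla.
  have hp := mem_head0 (box_ne hTi lt).
  have /(MVT_bound _ hla hTi) b := hT.
  rewrite -(hw_box hla hTi yT hp); apply: b.
  by apply/mem_word_of; exists (k, 0); rewrite (mem_mv_rd hla hTi).
have [t ht] := highest_tab_ex hmu le_mn; exists t => //.
have -> : hw_crystal n mu = @cr_closure n (hw_crystal n mu) t.
  by rewrite /cr_closure generated_SSYT.
have wS := SSYT_word_crystal n hmu; have wM := MVT_word_crystal n hla.
have /(hw_yamanouchi _ hmu)[[hts _] yt] := highest_singleton hmu ht.
have [_ wt' _ _] := hw_weight hmu hts yt.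
have es : row_content (singleton_tab t) = mu.
  have [[[es _ _ _] _] _] := ht; rewrite -[RHS]es /row_content /singleton_tab -map_comp.
  apply: eq_map => s /=; elim: s => //= x s ->.
  by [].
rewrite es in wt'.
apply: (wc_closure_iso wM wS hT ht.1).
- move=> a a' ga ga' e.
  have [ha _] := wc_generated wM hT ga; have [ha' _] := wc_generated wM hT ga'.
  (* The operators keep each letter in its column, so within one component the words alone
     distinguish tableaux. *)
  have lab b : @generated n (MVT_crystal n la) T b ->
      [seq x.2.2 | x <- mv_rd b] = [seq x.2.2 | x <- mv_rd T].
    elim=> // i b1 b2 /andP[i0 _] gb <- /= E; have [hb _] := wc_generated wM hT gb.
      by have [_ /rdF_cols] := mv_eP hla hb i0 E.
    by have [_ /rdF_cols] := mv_fP hla hb E.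
  by apply: (mv_rd_inj hla ha ha' e); rewrite !lab.
- move=> a a' ga ga' e.
  have [ha _] := wc_generated wS ht.1 ga; have [ha' _] := wc_generated wS ht.1 ga'.
  exact: (tab_rd_inj hmu ha ha' e).
- rewrite /= -mv_rd_singleton; apply: plactic_perm_yamanouchi => //.
    by move=> x /mem_word_of[[r c]]; rewrite (mem_mv_rd hla hTi) => /(box_pos hTi).
  apply/allP => x _ /=; apply/eqP.
  rewrite (permP (perm_mv_rd hla hTi)) (permP (perm_mv_rd hmu hts)).
  by rewrite -!mset_seqE -!/(mv_wt _) wt wt'.
Qed.

Lemma part_eq mu mu' : is_partition mu -> is_partition mu' ->
  (forall r, nth 0 mu r = nth 0 mu' r) -> mu = mu'.
Proof.
move=> [_ n0] [_ n0'] e; apply: (@eq_from_nth _ 0) => [|r _]; last exact: e.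
have aux s s' : 0 \notin s -> (forall r, nth 0 s r = nth 0 s' r) ->
    size s <= size s'.
  move=> s0 es; rewrite leqNgt; apply/negP => lt.
  by move: s0; rewrite -{1}(nth_default 0 (leqnn (size s'))) -es mem_nth.
by apply/eqP; rewrite eqn_leq !aux.
Qed.

Lemma weight_is_inj m mu mu' : is_partition mu -> is_partition mu' ->
  weight_is m mu -> weight_is m mu' -> mu = mu'.
Proof.
move=> hmu hmu' w w'; apply: part_eq => // r.
by have /= <- := w r.+1; have /= <- := w' r.+1.
Qed.

Lemma hw_row_content n la T : is_partition la ->
  @highest_weight n (MVT_crystal n la) T ->
  [/\ is_partition (row_content T), weight_is (mv_wt T) (row_content T),
      part_incl la (row_content T) & size (row_content T) = size la].
Proof. by move=> hla /(hw_yamanouchi _ hla)[[hT _]]; exact: hw_weight. Qed.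

(** Transport to semistandard tableaux, where the highest weight element is unique. *)
Lemma hw_uniq n la H H' T : is_partition la ->
  @highest_weight n (MVT_crystal n la) H ->
  @highest_weight n (MVT_crystal n la) H' ->
  @generated n (MVT_crystal n la) H T -> @generated n (MVT_crystal n la) H' T ->
  H = H'.
Proof.
move=> hla hw hw' g g'; have wM := MVT_word_crystal n hla.
have gH : @generated n (MVT_crystal n la) H H'.
  exact: generated_trans g (wc_generated_sym wM hw'.1 g').
have [t _ [_ _ [f [[ff fi _] _ fe _]]]] := closure_hw_iso hla hw.
have [hmu _ _ _] := hw_row_content hla hw.
have g0 := @Generated0 n (MVT_crystal n la) H.
apply: fi; rewrite ?inE //=.
apply: (highest_tab_uniq (n := n) hmu); split; try exact: ff.
  by move=> i ni; have /= -> := fe i H ni g0; have /= -> := hw.2 i ni.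
by move=> i ni; have /= -> := fe i H' ni gH; have /= -> := hw'.2 i ni.
Qed.

(** * Decomposition of the whole crystal *)

Definition hw_set (n : nat) (la mu : seq nat) : set mvtab :=
  [set T : mvtab |
    @highest_weight n (MVT_crystal n la) T /\ weight_is (mv_wt T) mu].

Lemma MVT_iso n la : is_partition la ->
  crystal_iso n (MVT_crystal n la)
    (cr_sum [set mu | is_partition mu /\ part_incl la mu]
       (fun mu => cr_copies (hw_mult n la mu) (hw_crystal n mu))).
Proof.
move=> hla; have wM := MVT_word_crystal n hla.
split; first exact: wc_stable wM.
  move=> i [mu [k t]] [mu' [k' t']] ni /= [[hmu incl] [/= kl ht]] E.
  have [Et Ek Emu] : [/\ (tab_e i t = Some t' \/ tab_f i t = Some t'), k' = k & mu' = mu].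
    (* Mapping nested dependent pairs to plain ones lets an equality between them be split into
       components. *)
    pose p (x : {mu : seq nat & {_ : nat & tab}}) :=
      (tag x, (tag (tagged x), tagged (tagged x))).
    case: E; [case Et: (tab_e i t) => [t1|] //=|case Et: (tab_f i t) => [t1|] //=];
      move=> /(congr1 (omap p)) [-> -> ->]; split=> //; by [left|right].
  by subst; split=> //; split=> //; exact: (wc_stable (SSYT_word_crystal n hmu) ni ht Et).
(* [hi] chooses the highest weight element of the component of [T]; [F] below chooses an isomorphism
   from that component to semistandard tableaux. *)
have [hi hiP] : {hi : mvtab -> mvtab & forall T, MVT n la T ->
    @highest_weight n (MVT_crystal n la) (hi T) /\
    @generated n (MVT_crystal n la) (hi T) T}.
  apply: (@choice _ _ (fun T H => MVT n la T ->
    @highest_weight n (MVT_crystal n la) H /\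
    @generated n (MVT_crystal n la) H T)) => T.
  have [hT|nT] := pselect (MVT n la T); last by exists T.
  by have [h hw g] := wc_highest wM hT; exists h.
pose isoP H (f : mvtab -> tab) := @highest_weight n (MVT_crystal n la) H ->
  [/\ set_bij (@generated n (MVT_crystal n la) H) (SSYT n (row_content H)) f,
      forall a, @generated n (MVT_crystal n la) H a -> tab_wt (f a) = mv_wt a,
      forall i a, 0 < i < n -> @generated n (MVT_crystal n la) H a ->
        tab_e i (f a) = omap f (mv_e i a)
    & forall i a, 0 < i < n -> @generated n (MVT_crystal n la) H a ->
        tab_f i (f a) = omap f (mv_f i a)].
have [F FP] : {F : mvtab -> mvtab -> tab & forall H, isoP H (F H)}.
  apply: (@choice _ _ isoP) => H.
  have [hw|nw] := pselect (@highest_weight n (MVT_crystal n la) H); last first.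
    by exists (fun=> [::]).
  by have [t _ [_ _ [f fP]]] := closure_hw_iso hla hw; exists f.
pose S mu := hw_set n la mu.
have finS mu : finite_set (S mu) by exact: hw_mult_finite.
(* The position of [H] among the highest weight elements of its weight numbers the copy. *)
pose idx H := index H (fset_set (S (row_content H))).
have inS H mu : @highest_weight n (MVT_crystal n la) H ->
    weight_is (mv_wt H) mu -> H \in fset_set (S mu).
  by move=> hw wt; rewrite in_fset_set // inE.
have hi_eq H T : @highest_weight n (MVT_crystal n la) H ->
    @generated n (MVT_crystal n la) H T -> hi T = H.
  move=> hw g; have hT : MVT n la T := wc_generated wM hw.1 g.
  by have [hw' g'] := hiP T hT; exact: hw_uniq hla hw' hw g' g.
pose B mu := cr_copies (hw_mult n la mu) (hw_crystal n mu).
pose mk (mu : seq nat) (k : nat) (t : tab) : {mu & cr_sort (B mu)} :=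
  existT (fun mu => cr_sort (B mu)) mu (existT (fun=> tab) k t).
pose psi T := mk (row_content (hi T)) (idx (hi T)) (F (hi T) T).
pose p (x : {mu : seq nat & {_ : nat & tab}}) :=
  (tag x, (tag (tagged x), tagged (tagged x))).
exists psi; split.
- split.
  + move=> T /= hT; have [hw g] := hiP T hT.
    have [hmu wt incl _] := hw_row_content hla hw.
    have [[ff _ _] _ _ _] := FP _ hw.
    split=> //; split; last exact: ff.
    by have := inS _ _ hw wt; rewrite -index_mem.
  + move=> T T'; rewrite !inE /= => hT hT' /(congr1 p) [emu ek et].
    have [hw g] := hiP T hT; have [hw' g'] := hiP T' hT'.
    have [hmu wt incl _] := hw_row_content hla hw.
    have [hmu' wt' incl' _] := hw_row_content hla hw'.
    have eH : hi T = hi T'.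
      rewrite -(nth_index [::] (inS _ _ hw wt)) -/(idx _) ek emu.
      by rewrite nth_index //; exact: inS.
    have [[_ fi _] _ _ _] := FP _ hw.
    by rewrite -eH in g' et; apply: fi; rewrite ?inE.
  + move=> [mu [k t]] /= [[hmu incl] [/= kl ht]].
    pose H := nth [::] (fset_set (S mu)) k.
    have : H \in fset_set (S mu) by rewrite mem_nth.
    rewrite in_fset_set // inE => -[hw wtH].
    have [hmu' wt' _ _] := hw_row_content hla hw.
    have emu : row_content H = mu by exact: weight_is_inj hmu' hmu wt' wtH.
    have [[_ _ fs] _ _ _] := FP _ hw.
    rewrite emu in fs; have [T g eT] := fs t ht.
    exists T; first exact: (wc_generated wM hw.1 g).
    rewrite /psi (hi_eq _ _ hw g) eT /idx emu.
    by rewrite /H index_uniq //; exact: fset_uniq.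
- move=> T hT; have [hw g] := hiP T hT; have [_ wt _ _] := FP _ hw.
  exact: wt.
- move=> i T ni hT; have [hw g] := hiP T hT; have [_ _ fe _] := FP _ hw.
  rewrite /= fe //; case E: (mv_e i T) => [T'|] //=.
  have g' : @generated n (MVT_crystal n la) (hi T) T' by exact: GeneratedE ni g E.
  by rewrite /psi (hi_eq _ _ hw g').
- move=> i T ni hT; have [hw g] := hiP T hT; have [_ _ _ ff] := FP _ hw.
  rewrite /= ff //; case E: (mv_f i T) => [T'|] //=.
  have g' : @generated n (MVT_crystal n la) (hi T) T' by exact: GeneratedF ni g E.
  by rewrite /psi (hi_eq _ _ hw g').
Qed.

(** * Expansion in Schur functions *)

(** By [hw_box] the letters of a highest weight tableau are at most [size la], so a bound
    [n >= size la] excludes none of them. For smaller [n] there is no tableau at all, and the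
    multiplicities vanish. *)
Lemma hw_mult_stable n N la mu : is_partition la -> size la <= n -> n <= N ->
  hw_mult N la mu = hw_mult n la mu.
Proof.
move=> hla sn nN; rewrite /hw_mult; congr (#|` fset_set _ |%fset).
apply/seteqP; split=> T /= [/(hw_yamanouchi _ hla)[hT yT] wt]; split=> //;
  apply/(hw_yamanouchi _ hla); split=> //; have [hTi bT] := hT.
  apply/(MVT_bound n hla hTi) => x /mem_word_of[[r c]].
  rewrite (mem_mv_rd hla hTi) => xp; rewrite (hw_box hla hTi yT xp).
  exact: leq_trans (part_size (box_in_shape hTi xp)) sn.
by split=> // x /bT xn; exact: leq_trans xn nN.
Qed.

Lemma finite_part_sum (D : set (seq nat)) k :
  finite_set [set mu : seq nat | D mu /\ 0 \notin mu /\ sumn mu = k].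
Proof.
(* A list of positive parts with sum [k] has at most [k] parts, each at most [k]; padding by zeros
   gives the tuple. *)
pose g (u : k.-tuple 'I_k.+1) := [seq x <- map val u | x != 0].
apply: (@sub_finite_set _ _ (g @` setT)); last exact/finite_image/finite_finset.
move=> mu /= [_ [n0 ek]].
have le_size : size mu <= k.
  rewrite -ek; elim: mu n0 {ek} => //= x s IH.
  by rewrite inE negb_or => /andP[x0 /IH]; lia.
have le_mem x : x \in mu -> x <= k.
  rewrite -ek; elim: mu {n0 ek le_size} => //= y s IH.
  by rewrite inE => /predU1P[->|/IH]; lia.
have sz : size (map (fun x => inord x : 'I_k.+1) (mu ++ nseq (k - size mu) 0)) == k.
  by rewrite size_map size_cat size_nseq subnKC.
exists (Tuple sz) => //; rewrite /g /= -map_comp.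
rewrite (_ : map _ _ = mu ++ nseq (k - size mu) 0).
  rewrite filter_cat filter_nseq /= cats0.
  by apply/all_filterP/allP => x xm; apply: contraNneq n0 => <-.
rewrite -[RHS]map_id; apply/eq_in_map => x; rewrite mem_cat mem_nseq /= => h.
rewrite inordK // ltnS; case/orP: h => [/le_mem //|/andP[_ /eqP->] //].
Qed.

Lemma size_wt (s : seq nat) (m : weight) : seq_mset s = m ->
  size s = size (enum_mset m).
Proof. by move=> <-; exact/esym/perm_size/perm_eq_seq_mset. Qed.

Lemma fsum_seq (I : choiceType) (A : set I) (r : seq I) (F : I -> {poly int}) :
  uniq r -> [set` r] `<=` A -> (forall i, A i -> i \notin r -> F i = 0%R) ->
  (\sum_(i \in A) F i = \sum_(i <- r) F i)%R.
Proof.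
move=> ur rA F0; rewrite (fsbigE r) // big_seq_cond [RHS]big_seq.
apply: eq_bigl => i; case: (boolP (i \in r)) => //= ir.
by apply/asboolP/rA.
Qed.

Section Expansion.
Variables (n : nat) (la : seq nat).
Hypotheses (hla : is_partition la) (sn : size la <= n).
Variable m : weight.

Local Notation D := [set mu | is_partition mu /\ part_incl la mu].

Let k := size (enum_mset m).

Let tabs mu : set tab := [set t | SSYT_inf mu t /\ tab_wt t = m].

Lemma tabs_finite mu : finite_set (tabs mu).
Proof.
by apply: sub_finite_set (finite_tab mu m) => t [[es _ _ _] wt].
Qed.

(** The coefficient is a Kostka number. *)
Lemma schur_coef mu : schur mu m = ((size (fset_set (tabs mu)))%:R)%R.
Proof.
have inE' t : (t \in fset_set (tabs mu)) = (t \in tabs mu).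
  by rewrite in_fset_set //; exact: tabs_finite.
rewrite /schur /series_sum (fsum_seq (r := fset_set (tabs mu))).
- rewrite big_seq (eq_bigr (fun=> 1%R)); last first.
    by move=> t; rewrite inE' inE => -[_ wt]; rewrite /schur_term /monom wt eqxx.
  by rewrite -big_seq big_const_seq count_predT GRing.iter_addr_0.
- exact: fset_uniq.
- by move=> t /=; rewrite inE' inE => -[].
- move=> t ht; rewrite inE' /schur_term /monom; case: eqP => // e /negP[].
  by rewrite inE.
Qed.

Lemma tabs_sumn mu t : tabs mu t -> sumn mu = k.
Proof.
by move=> [[es _ _ _] wt]; rewrite -es -size_flatten; exact: size_wt.
Qed.

Lemma schur_coef0 mu : sumn mu != k -> schur mu m = 0%R.
Proof.
move=> nk; rewrite schur_coef; suff -> : tabs mu = set0 by rewrite fset_set0.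
by apply/seteqP; split=> // t /tabs_sumn e; rewrite e eqxx in nk.
Qed.

Let Dk : set (seq nat) := [set mu | D mu /\ 0 \notin mu /\ sumn mu = k].

Let term mu : {poly int} :=
  ('X^(sumn mu - sumn la) *+ hw_mult n la mu * schur mu m)%R.

Lemma term_Dk mu : D mu -> term mu != 0%R -> Dk mu.
Proof.
move=> hmu; have [[_ n0] _] := hmu; have [ek _|nk] := eqVneq (sumn mu) k.
  by split.
by rewrite /term schur_coef0 // GRing.mulr0 eqxx.
Qed.

Lemma in_Dk mu : (mu \in fset_set Dk) = (mu \in Dk).
Proof. by rewrite in_fset_set //; exact: finite_part_sum. Qed.

Lemma term_sum : series_sum D (fun mu _ => term mu) m =
  ('X^(k - sumn la) *+
    \sum_(mu <- fset_set Dk) hw_mult n la mu * size (fset_set (tabs mu)))%R.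
Proof.
rewrite /series_sum (fsum_seq (r := fset_set Dk)); first last.
- move=> mu hmu; rewrite in_Dk; apply: contraNeq => /(term_Dk hmu) h.
  by rewrite inE.
- by move=> mu /=; rewrite in_Dk inE => -[].
- exact: fset_uniq.
rewrite -GRing.sumrMnr big_seq [RHS]big_seq; apply: eq_bigr => mu.
rewrite in_Dk inE => -[_ [_ ek]]; rewrite /term schur_coef ek.
by rewrite GRing.mulrnA GRing.mulr_natr.
Qed.

Let mvts : set mvtab := [set T | MVT_inf la T /\ mv_wt T = m].

Lemma in_mvts T : (T \in fset_set mvts) = (T \in mvts).
Proof.
rewrite in_fset_set //.
by apply: sub_finite_set (finite_mvtab la m) => t [[es _ _ _] wt].
Qed.

Lemma wgroth_coef :
  wgroth la m = ('X^(k - sumn la) *+ size (fset_set mvts))%R.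
Proof.
rewrite /wgroth /series_sum (fsum_seq (r := fset_set mvts)).
- rewrite big_seq (eq_bigr (fun=> 'X^(k - sumn la))%R); last first.
    move=> T; rewrite in_mvts inE => -[_ wt].
    by rewrite /wgroth_term /monom wt eqxx (size_wt wt).
  by rewrite -big_seq big_const_seq count_predT GRing.iter_addr_0.
- exact: fset_uniq.
- by move=> T /=; rewrite in_mvts inE => -[].
- move=> T hT; rewrite in_mvts /wgroth_term /monom; case: eqP => // e /negP[].
  by rewrite inE.
Qed.

Lemma size_mvts : size (fset_set mvts) =
  \sum_(mu <- fset_set Dk) hw_mult n la mu * size (fset_set (tabs mu)).
Proof.
(* Each letter of [m] is at most the sum of all, so every tableau of weight [m] lies in [MVT N la];
   adding [n] ensures [n <= N], so that the multiplicities for [N] are those for [n]. *)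
pose N := n + sumn (enum_mset m).
have le_N (s : seq nat) : seq_mset s = m -> {in s, forall x, x <= N}.
  move=> es x xs; have : x \in enum_mset m.
    by rewrite -es (perm_mem (perm_eq_seq_mset _)).
  move=> xm; apply: leq_trans (leq_addl n _).
  elim: (enum_mset m) xm => //= y t IH; rewrite inE => /predU1P[->|/IH]; lia.
have eM mu : hw_mult N la mu = hw_mult n la mu.
  by apply: hw_mult_stable => //; exact: leq_addr.
have [_ _ [psi [[pf pi ps] pw _ _]]] := MVT_iso N hla.
pose p (x : {mu : seq nat & {_ : nat & tab}}) :=
  (tag x, (tag (tagged x), tagged (tagged x))).
have pK : injective p by move=> [mu [j t]] [mu' [j' t']] [-> -> ->].
pose L := [seq (mu, jt) | mu <- fset_set Dk,
  jt <- [seq (j, t) | j <- iota 0 (hw_mult n la mu), t <- fset_set (tabs mu)]].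
have mN T : mvts T -> MVT N la T.
  by move=> [hT wt]; split=> //; exact: le_N wt.
have in_tabs mu t : (t \in fset_set (tabs mu)) = (t \in tabs mu).
  by rewrite in_fset_set //; exact: tabs_finite.
transitivity (size L); last first.
  rewrite size_allpairs_dep sumnE big_map; apply: eq_bigr => mu _.
  by rewrite size_allpairs size_iota.
rewrite -(size_map (p \o psi)); apply: perm_size; apply: uniq_perm.
- rewrite map_inj_in_uniq ?fset_uniq // => T T'.
  rewrite !in_mvts !inE => hT hT' /pK; apply: pi; rewrite inE; exact: mN.
- apply: allpairs_uniq_dep; first exact: fset_uniq.
    move=> mu _; apply: allpairs_uniq; rewrite ?iota_uniq ?fset_uniq //.
    by move=> [? ?] [? ?] _ _ [-> ->].
  by move=> [mu jt] [mu' jt'] _ _ /= [-> ->].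
move=> x; apply/mapP/allpairsPdep => /=.
  move=> [T]; rewrite in_mvts inE => hT ->; have hTN := mN T hT.
  have := pf T hTN; have := pw T hTN; rewrite /=.
  case: (psi T) => mu [j t] /= wt [[hmu incl] [/= jl [ht _]]].
  have tm : tabs mu t by split=> //; rewrite wt; case: hT.
  exists mu, (j, t); split=> //.
    rewrite in_Dk inE; split=> //; split; first by case: hmu.
    exact: tabs_sumn tm.
  apply/allpairsPdep; exists j, t; split=> //.
    by rewrite mem_iota /= add0n -eM.
  by rewrite in_tabs inE.
move=> [mu [jt [+ + ->]]]; rewrite in_Dk inE => -[[hmu incl] _].
move=> /allpairsPdep[j [t [+ + ->]]]; rewrite mem_iota /= add0n in_tabs inE.
move=> jl [ht wt].
pose B mu := cr_copies (hw_mult N la mu) (hw_crystal N mu).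
pose y : {mu & cr_sort (B mu)} :=
  existT (fun mu => cr_sort (B mu)) mu (existT (fun=> tab) j t).
have [|T hT eT] := ps y.
  by split=> //; split; [rewrite /= eM|split=> //; exact: le_N wt].
exists T; last by rewrite /= eT.
rewrite in_mvts inE; split; first by case: hT.
by have := pw T hT; rewrite eT /= => <-.
Qed.

End Expansion.

Theorem theorem3p9 (n : nat) (la : seq nat) (hn : 2 <= n)
    (hla : is_partition la) :
  [/\ forall T : mvtab, @highest_weight n (MVT_crystal n la) T ->
        exists mu : seq nat,
          [/\ is_partition mu, weight_is (mv_wt T) mu
            & crystal_iso n (@cr_closure n (MVT_crystal n la) T)
                            (hw_crystal n mu)],
      crystal_iso n (MVT_crystal n la)
        (cr_sum [set mu | is_partition mu /\ part_incl la mu]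
           (fun mu => cr_copies (hw_mult n la mu) (hw_crystal n mu)))
    & size la <= n ->
      let term mu : mseries := fun m =>
        ('X^(sumn mu - sumn la) *+ hw_mult n la mu * schur mu m)%R in
      locally_finite [set mu | is_partition mu /\ part_incl la mu] term /\
      wgroth la =
        series_sum [set mu | is_partition mu /\ part_incl la mu] term].
Proof.
split; last 1 first.
- move=> sn term; split.
    move=> m; apply: sub_finite_set (finite_part_sum
      [set mu | is_partition mu /\ part_incl la mu] (size (enum_mset m))).
    by move=> mu [hmu]; exact: term_Dk.
  (* For fixed [m] each nonzero term has [sumn mu] equal to the degree of [m], so all powers of
     alpha agree and only the count of tableaux remains. *)
  apply/funext => m; rewrite (wgroth_coef la m) (size_mvts hla sn).
  by rewrite -term_sum.
- move=> T hw; exists (row_content T).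
  have [hmu wt _ _] := hw_row_content hla hw.
  by have [_ _ iso] := closure_hw_iso hla hw; split.
- exact: MVT_iso.
Qed.
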